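(* Almost every matroid has a minor isomorphic to $\mathcal{W}^3$ or to $M(K_4)$. That is, if $m(n)$ denotes the number of matroids on the ground set $[n]=\{1,\dots,n\}$ and $m_{\mathcal{X}}(n)$ denotes the number of those having no minor isomorphic to $\mathcal{W}^3$ or $M(K_4)$, then $m_{\mathcal{X}}(n)/m(n)\to 0$ as $n\to\infty$.
   Context: $\mathcal{W}^3$ is the rank-3 whirl: the rank-3 matroid on a 6-element set $\{a,b,c,d,e,f\}$ whose only 3-element circuits (dependent 3-sets) are $\{a,b,c\},\{c,d,e\},\{e,f,a\}$; all other 3-subsets are bases. $M(K_4)$ is the cycle matroid of the complete graph $K_4$; equivalently the rank-3 matroid on $\{a,b,c,d,e,f\}$ whose only dependent 3-sets are $\{a,b,c\},\{c,d,e\},\{e,f,a\},\{b,d,f\}$. Matroids are counted as labelled matroids on the ground set $[n]$. *)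

(* Defs.v *)
From mathcomp Require Import all_boot all_order all_algebra.
Set Implicit Arguments. Unset Strict Implicit. Unset Printing Implicit Defensive.

Definition is_matroid (T : finType) (I : {set {set T}}) : bool :=
  [&& set0 \in I,
      [forall Y : {set T}, forall X : {set T},
          (Y \in I) && (X \subset Y) ==> (X \in I)] &
      [forall Y : {set T}, forall Z : {set T},
          [&& Y \in I, Z \in I & #|Y| < #|Z|] ==>
          [exists z in Z :\: Y, z |: Y \in I]]].

Definition mrank (T : finType) (I : {set {set T}}) (X : {set T}) : nat :=
  \max_(Y : {set T} | (Y \in I) && (Y \subset X)) #|Y|.

Definition indep_contract (T : finType) (I : {set {set T}}) (C X : {set T}) : bool :=
  [disjoint X & C] && (mrank I (X :|: C) == #|X| + mrank I C).

(* M (on T) has a minor isomorphic to N (a matroid on 'I_k):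
   there are a contraction set C and an injection f : 'I_k -> T whose image E'
   is disjoint from C, such that f is an isomorphism from N onto
   M / C \ (T \ (C u E')). *)
Definition has_minor_iso (T : finType) (I : {set {set T}}) (k : nat)
    (N : {set {set 'I_k}}) : bool :=
  [exists C : {set T}, exists f : {ffun 'I_k -> T},
    [&& injectiveb f, [disjoint C & f @: setT] &
        [forall S : {set 'I_k}, (S \in N) == indep_contract I C (f @: S)]]].

Definition ia : 'I_6 := @Ordinal 6 0 isT.
Definition ib : 'I_6 := @Ordinal 6 1 isT.
Definition ic : 'I_6 := @Ordinal 6 2 isT.
Definition id_ : 'I_6 := @Ordinal 6 3 isT.
Definition ie : 'I_6 := @Ordinal 6 4 isT.
Definition iff_ : 'I_6 := @Ordinal 6 5 isT.

Definition W3 : {set {set 'I_6}} :=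
  [set S : {set 'I_6} | (#|S| <= 3) &&
     [&& S != [set ia; ib; ic], S != [set ic; id_; ie] & S != [set ie; iff_; ia]]].

Definition MK4 : {set {set 'I_6}} :=
  [set S : {set 'I_6} | (#|S| <= 3) &&
     [&& S != [set ia; ib; ic], S != [set ic; id_; ie],
         S != [set ie; iff_; ia] & S != [set ib; id_; iff_]]].

Definition num_matroids (n : nat) : nat :=
  #|[set I : {set {set 'I_n}} | is_matroid I]|.

Definition num_excl (n : nat) : nat :=
  #|[set I : {set {set 'I_n}} | is_matroid I &&
       ~~ has_minor_iso I W3 && ~~ has_minor_iso I MK4]|.

(* Main.v *)
Require Import Defs.
From mathcomp Require Import all_boot all_order all_algebra.
From mathcomp Require Import ring lra zify.
Set Implicit Arguments. Unset Strict Implicit. Unset Printing Implicit Defensive.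
Import Order.TTheory GRing.Theory Num.Theory.

(** Contracting a set of size r - 3 from a rank-r matroid gives a rank-3 matroid, and a
    rank-3 matroid without W^3 and M(K_4) has no triangle of lines with at least three
    points: a third point on each side would complete one of the two minors.  By the
    Ruzsa-Szemeredi (6,3)-theorem such lines have o(n^2) incidences in total, so the
    matroid is encoded by its parallel classes and a set of o(n^2) pairs of points, and
    there are only 2^(o(n^2)) of them.  Shearer's inequality, applied to the families of
    bases containing a given (r - 3)-set, lifts this to the bound
    2^(o(C(n, r) / n)) on the number of rank-r matroids in the class, whereas sparse
    paving matroids built from the Graham-Sloane classes (r-sets with a given sum modulo
    n) show that there are at least 2^(C(n, n/2) / n) matroids. *)

(** * The Ruzsa-Szemeredi theorem by energy increment *)

Local Open Scope ring_scope.

(** The lower bound fixes the scale to beat: the logarithm of the number of matroids is at least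
    C(n, n/2) / n, up to a constant, while the trivial bound for rank r is C(n, r), too large by a
    factor n. In rank 3 this factor is the gap between C(n, 3) and n^2, and Shearer's inequality
    carries the ratio of the logarithm of the count to C(n, 3) over to higher rank. A bound O(n^2)
    in rank 3 would only match the lower bound up to a constant, so the o(n^2) of the (6,3)-theorem,
    used with one large fixed constant, is decisive. A contraction keeps the ground set [n], with
    the contracted elements as loops, so its count is bounded in terms of n, whereas Shearer's
    inequality gains only C(n - r + 3, 3). The two are comparable as long as n - r is at least n/4;
    for the remaining ranks, and for r < 3, the trivial bound is enough, since there C(n, r) is
    below C(n, n/2) / (2n). Each rank is brought down to the square root of the number of matroids,
    which leaves room for the n + 1 ranks and any constant factor. *)

Section Increment.
Variables (V : finType) (tr : V -> V -> V -> bool).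
Hypothesis tr12 : forall x y z, tr x y z = tr y x z.
Hypothesis tr23 : forall x y z, tr x y z = tr x z y.
Hypothesis tr_uniq : forall x y z z', tr x y z -> tr x y z' -> z = z'.
Let adj x y := [exists z, tr x y z].
Hypothesis tri : forall x y z, adj x y -> adj y z -> adj x z -> tr x y z.

Let G x y : rat := (adj x y)%:R.
Let n : rat := #|V|%:R.

(* Its maximum over h of the form g (c x) (c y) is attained at the edge densities between
   colour classes; allowing an arbitrary h avoids dividing by the sizes of the classes. *)
Definition energy (h : V -> V -> rat) : rat :=
  \sum_x \sum_y (2 * h x y * G x y - h x y ^+ 2).

Lemma adj_indicator_bounds x y : 0 <= G x y <= 1.
Proof. by rewrite /G; case: (adj x y). Qed.

Lemma adj_indicator_sqr x y : G x y ^+ 2 = G x y.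
Proof. by rewrite /G; case: (adj x y); rewrite ?expr1n ?expr0n. Qed.

Lemma sum_const1 (k : rat) : \sum_(x : V) k = k * n.
Proof. by rewrite sumr_const mulr_natr. Qed.

Lemma sum_const2 (k : rat) : \sum_(x : V) \sum_(y : V) k = k * n ^+ 2.
Proof. by rewrite !sum_const1 -mulrA -expr2. Qed.

Lemma energy_le h : energy h <= n ^+ 2.
Proof.
rewrite -[leRHS]mul1r -sum_const2.
apply: ler_sum => x _; apply: ler_sum => y _.
have := sqr_ge0 (h x y - G x y); rewrite sqrrB adj_indicator_sqr; have /andP[? ?] := adj_indicator_bounds x y; lra.
Qed.

Lemma sum_tr3 x y : \sum_z (tr x y z)%:R = G x y.
Proof.
rewrite /G; case: (boolP (adj x y)) => [/existsP[z trz]|].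
  rewrite (bigD1 z) //= trz big1 ?addr0 // => z' /eqP ne.
  by case: (boolP (tr x y z')) => // /(tr_uniq trz) /esym.
by rewrite negb_exists => /forallP H; rewrite big1 // => z _; rewrite (negbTE (H z)).
Qed.

Variables (Q : finType) (c : V -> Q) (g : Q -> Q -> rat).

Let a i : rat := \sum_(y | c y == i) 1.
Let ax x i : rat := \sum_(y | c y == i) G x y.

Lemma a_ge0 i : 0 <= a i. Proof. exact: sumr_ge0. Qed.
Lemma ax_ge0 x i : 0 <= ax x i.
Proof. by apply: sumr_ge0 => y _; case/andP: (adj_indicator_bounds x y). Qed.
Lemma sum_a : \sum_i a i = n.
Proof.
transitivity (\sum_(y : V) (1 : rat)); first by rewrite [RHS](partition_big c predT).
by rewrite sumr_const.
Qed.


(** Cleaning as in the removal lemma: a class where [x] has density below [eta] holds few edges at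
    [x], and summing over the classes costs at most [eta * n] edges. *)
Lemma sum_small_nbrs (eta : rat) x :
  0 <= eta -> \sum_y G x y * (ax x (c y) < eta * a (c y))%R%:R <= eta * n.
Proof.
move=> e0; rewrite (partition_big c predT) //= -sum_a mulr_sumr.
apply: ler_sum => i _.
rewrite (eq_bigr (fun y => G x y * (ax x i < eta * a i)%R%:R)); last by move=> y /eqP->.
rewrite -mulr_suml -/(ax x i).
by case: ltP => [/ltW|] /=; rewrite ?mulr1 // mulr0 => _; rewrite mulr_ge0 ?a_ge0.
Qed.

Lemma sum_small_class (kap : rat) :
  0 <= kap -> \sum_y (a (c y) < kap)%R%:R <= kap * #|Q|%:R.
Proof.
move=> e0; rewrite (partition_big c predT) //=.
have -> : kap * #|Q|%:R = \sum_(i : Q) kap by rewrite sumr_const mulr_natr.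
apply: ler_sum => i _.
rewrite (eq_bigr (fun y => 1 * (a i < kap)%R%:R)); last by move=> y /eqP->; rewrite mul1r.
rewrite -mulr_suml -/(a i).
by case: ltP => [/ltW|] /=; rewrite ?mulr1 // mulr0.
Qed.

Variables (eps : rat).
Hypotheses (eps_gt0 : 0 < eps) (eps_le1 : eps <= 1).
(** Cleaning loses less than [6 * tau * n ^ 2] triples: three units for low values of [h], one for
    each of two sparse neighbourhoods, one for small classes. This is half of the available
    [eps * n ^ 2]. *)
Let tau : rat := eps / 12.
Let h x y := g (c x) (c y).

Hypothesis many : eps * n ^+ 2 <= \sum_x \sum_y \sum_z (tr x y z)%:R.

Let S1 : rat := \sum_y \sum_z (h y z < tau)%R%:R * G y z.

(** On a pair with [h < tau], adding [tau] gains [2 * tau * (G - h) - tau ^ 2], which is at least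
    [2 * tau * G - 3 * tau ^ 2]. The factor 3 in the hypothesis makes the gain on edges twice the
    possible total loss. The colour classes do not change. *)
Lemma energy_raise : 3 * tau * n ^+ 2 <= S1 ->
  energy h + 3 * tau ^+ 2 * n ^+ 2 <= energy (fun x y => h x y + tau * (h x y < tau)%R%:R).
Proof.
move=> big.
have : \sum_y \sum_z (2 * tau * ((h y z < tau)%R%:R * G y z) - 3 * tau ^+ 2) <=
   energy (fun x y => h x y + tau * (h x y < tau)%R%:R) - energy h.
  rewrite /energy -sumrB; apply: ler_sum => x _; rewrite -sumrB.
  apply: ler_sum => y _.
  have t0 : 0 < tau by rewrite /tau divr_gt0.
  have t2 : 0 < tau ^+ 2 by rewrite exprn_gt0.
  case: ltP => hx; rewrite ?mulr1n ?mulr0n ?mulr1 ?mulr0 ?mul0r ?addr0 ?mul1r ?subrr; last by lra.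
  have := mulr_gt0 t0 (_ : 0 < tau - h x y); rewrite subr_gt0 => /(_ hx); lra.
have -> : \sum_y \sum_z (2 * tau * ((h y z < tau)%R%:R * G y z) - 3 * tau ^+ 2) =
  2 * tau * S1 - 3 * tau ^+ 2 * n ^+ 2.
  rewrite -sum_const2 /S1 mulr_sumr -sumrB; apply: eq_bigr => x _.
  by rewrite mulr_sumr -sumrB; apply: eq_bigr => y _.
have t0 : 0 < tau by rewrite /tau divr_gt0.
nra.
Qed.

(** With this threshold all small classes together contain at most [tau * n] vertices. *)
Let kap : rat := tau * n / #|Q|%:R.
Let good x y z := [&& tr x y z, tau <= h y z, tau * a (c y) <= ax x (c y),
  tau * a (c z) <= ax x (c z) & kap <= a (c y)].

Hypothesis Q0 : (0 < #|Q|)%N.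

Lemma sum_good : S1 < 3 * tau * n ^+ 2 ->
  eps / 2 * n ^+ 2 <= \sum_x \sum_y \sum_z (good x y z)%:R.
Proof.
move=> sml.
have t0 : 0 < tau by rewrite /tau divr_gt0.
have n0 : 0 <= n by rewrite /n.
have Q1 : 0 < #|Q|%:R :> rat by rewrite ltr0n.
have k0 : 0 <= kap by rewrite /kap !mulr_ge0 ?invr_ge0 // ltW.
pose b2 x y := (ax x (c y) < tau * a (c y)).
pose b4 y := (a (c y) < kap).
have le1 x y z : (tr x y z)%:R <= (good x y z)%:R + ((h y z < tau)%R%:R * (tr x y z)%:R
   + (b2 x y)%:R * (tr x y z)%:R + (b2 x z)%:R * (tr x z y)%:R + (b4 y)%:R * (tr x y z)%:R) :> rat.
  rewrite (tr23 x z y) /good; case: (tr x y z); last by rewrite !mulr0 /=; lra.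
  rewrite /b2 /b4 !mulr1 /=.
  by do 4![case: ltP => /=; rewrite ?andbF => _]; lra.
have E1 : \sum_x \sum_y \sum_z (h y z < tau)%R%:R * (tr x y z)%:R = S1.
  rewrite exchange_big; apply: eq_bigr => y _.
  rewrite exchange_big; apply: eq_bigr => z _.
  rewrite -mulr_sumr; congr (_ * _); rewrite -sum_tr3.
  by apply: eq_bigr => x _; rewrite tr12 tr23.
have E2 : \sum_x \sum_y \sum_z (b2 x y)%:R * (tr x y z)%:R <= tau * n ^+ 2.
  have -> : tau * n ^+ 2 = \sum_(x : V) tau * n by rewrite sum_const1 -mulrA -expr2.
  apply: ler_sum => x _.
  apply: le_trans (sum_small_nbrs x (ltW t0)).
  apply: ler_sum => y _.
  by rewrite -mulr_sumr sum_tr3 mulrC.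
have E3 : \sum_x \sum_y \sum_z (b2 x z)%:R * (tr x z y)%:R <= tau * n ^+ 2.
  rewrite (eq_bigr (fun x => \sum_y \sum_z (b2 x y)%:R * (tr x y z)%:R)) //.
  by move=> x _; rewrite exchange_big.
have E4 : \sum_x \sum_y \sum_z (b4 y)%:R * (tr x y z)%:R <= tau * n ^+ 2.
  have -> : tau * n ^+ 2 = \sum_(x : V) tau * n by rewrite sum_const1 -mulrA -expr2.
  apply: ler_sum => x _.
  have -> : tau * n = kap * #|Q|%:R by rewrite /kap mulfVK // lt0r_neq0.
  apply: le_trans (sum_small_class k0).
  apply: ler_sum => y _.
  rewrite -mulr_sumr sum_tr3 /b4; have := adj_indicator_bounds x y.
  by case: ltP => _ /=; rewrite ?mul1r ?mul0r; lra.
have : \sum_x \sum_y \sum_z (tr x y z)%:R <= \sum_x \sum_y \sum_z (good x y z)%:R +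
  (S1 + \sum_x \sum_y \sum_z (b2 x y)%:R * (tr x y z)%:R
   + \sum_x \sum_y \sum_z (b2 x z)%:R * (tr x z y)%:R
   + \sum_x \sum_y \sum_z (b4 y)%:R * (tr x y z)%:R).
  rewrite -E1 -!big_split /=; apply: ler_sum => x _.
  rewrite -!big_split /=; apply: ler_sum => y _.
  rewrite -!big_split /=; apply: ler_sum => z _.
  exact: le1.
have -> : eps / 2 = eps - 6 * tau by rewrite /tau; field.
move: many E2 E3 E4 sml.
move: (\sum_x _) (\sum_x _) (\sum_x _) (\sum_x _) (\sum_x _) S1 (n ^+ 2) tau.
move=> A B C D E F N t; lra.
Qed.

(* The neighbourhood of x spans a matching only, so one witness x for the classes i, j
   exhibits a rectangle, of positive proportion in the two classes, on which the value
   g i j >= tau badly overestimates the edge density. *)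
Let w i j := [pick x | [exists y, exists z, [&& good x y z, c y == i & c z == j]]].
Let nbr i j y := if w i j is Some x then adj x y else false.
Let R y z := nbr (c y) (c z) y && nbr (c y) (c z) z.

Hypothesis n_large : 4 <= tau ^+ 2 * kap.

(** The summand on the right is the change of energy when [h] drops by [tau / 2] on the rectangle.
    With [p = ax x i] and [q = ax x j], the terms in [h] give at least [tau ^ 2 * p * q], the other
    two cost at most a quarter of that each, and [p * q] is at least [tau ^ 2 * (a i * a j)]. *)
Lemma block_gain i j :
  (tau ^+ 4 / 2) * ((w i j != None)%:R * (a i * a j)) <=
  \sum_(y | c y == i) \sum_(z | c z == j) (R y z)%:R * (tau * (h y z - G y z) - tau ^+ 2 / 4).
Proof.
have t0 : 0 < tau by rewrite /tau divr_gt0.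
have -> : \sum_(y | c y == i) \sum_(z | c z == j) (R y z)%:R * (tau * (h y z - G y z) - tau ^+ 2 / 4) =
  \sum_(y | c y == i) \sum_(z | c z == j)
    (nbr i j y && nbr i j z)%:R * (tau * (g i j - G y z) - tau ^+ 2 / 4).
  apply: eq_bigr => y /eqP cy; apply: eq_bigr => z /eqP cz.
  by rewrite /R /h cy cz.
rewrite /nbr; case Ew: (w i j) => [x|] /=; last first.
  rewrite mul0r mulr0; apply: sumr_ge0 => y _; apply: sumr_ge0 => z _.
  by rewrite mul0r.
have [gt_g gt_i gt_j gt_k] : [/\ tau <= g i j, tau * a i <= ax x i, tau * a j <= ax x j & kap <= a i].
  move: Ew; rewrite /w; case: pickP => // x0 /existsP[y0 /existsP[z0]] + [xx].
  by rewrite xx => /and3P[/and5P[_ + + + +] /eqP<- /eqP<-]; rewrite /h.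
pose F := \sum_(y | c y == i) \sum_(z | c z == j) G x y * G x z * G y z.
(* For adjacent neighbours [y], [z] of [x], [tri] makes [x y z] a triple, so [z] determines [y]: the
   rectangle has at most [ax x j] edges. With at least [4 / tau] neighbours of [x] in class [i],
   these are negligible among its pairs. *)
have F_le : F <= ax x j.
  rewrite /F exchange_big; apply: ler_sum => z _ /=.
  apply: (@le_trans _ _ (\sum_(y | c y == i) (tr x z y)%:R)).
    apply: ler_sum => y _; rewrite /G -!natrM ler_nat !mulnb.
    case: (boolP (adj x y)) => //= xy; case: (boolP (adj x z)) => //= xz.
    by case: (boolP (adj y z)) => //= yz; rewrite tr23 tri.
  rewrite -sum_tr3 big_mkcond; apply: ler_sum => y _.
  by case: ifP.
have -> : \sum_(y | c y == i) \sum_(z | c z == j)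
    (adj x y && adj x z)%:R * (tau * (g i j - G y z) - tau ^+ 2 / 4) =
  (tau * g i j - tau ^+ 2 / 4) * (ax x i * ax x j) - tau * F.
  rewrite /F /ax mulr_suml !mulr_sumr -sumrB; apply: eq_bigr => y _.
  rewrite !mulr_sumr -sumrB; apply: eq_bigr => z _.
  by rewrite /G -mulnb natrM; ring.
rewrite mul1r.
have a0 := a_ge0 i; have b0 := a_ge0 j.
have q0 := ax_ge0 x j.
have p_ge : 4 <= tau * ax x i.
  apply: le_trans n_large _; rewrite expr2 -mulrA ler_pM2l //.
  by apply: le_trans gt_i; rewrite ler_pM2l.
have p0 : 0 <= ax x i by exact: ax_ge0.
have H1 : tau * F <= tau ^+ 2 / 4 * (ax x i * ax x j).
  have : 4 * ax x j <= tau * ax x i * ax x j by rewrite ler_wpM2r.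
  move=> H. have : tau * F <= tau * ax x j by rewrite ler_pM2l.
  move=> H'; apply: le_trans H' _.
  have -> : tau ^+ 2 / 4 * (ax x i * ax x j) = tau * ((tau * ax x i * ax x j) / 4) by field.
  by rewrite ler_pM2l //; lra.
have H2 : tau ^+ 2 * (a i * a j) <= ax x i * ax x j.
  have -> : tau ^+ 2 * (a i * a j) = (tau * a i) * (tau * a j) by ring.
  by apply: ler_pM => //; rewrite mulr_ge0 // ltW.
have H3 : tau ^+ 2 * (ax x i * ax x j) <= tau * g i j * (ax x i * ax x j).
  by rewrite ler_wpM2r ?mulr_ge0 // expr2 ler_pM2l.
have H4 : tau ^+ 4 * (a i * a j) <= tau ^+ 2 * (ax x i * ax x j).
  by rewrite (_ : 4 = 2 + 2)%N // exprD -mulrA ler_pM2l ?exprn_gt0.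
rewrite [leRHS](_ : _ = tau * g i j * (ax x i * ax x j)
  - tau ^+ 2 / 4 * (ax x i * ax x j) - tau * F); last by ring.
rewrite [tau ^+ 2 / 4 * _](_ : _ = tau ^+ 2 * (ax x i * ax x j) / 4) in H1 *; last by field.
rewrite [leLHS](_ : _ = tau ^+ 4 * (a i * a j) / 2); last by field.
by lra.
Qed.

Lemma energy_refine : S1 < 3 * tau * n ^+ 2 ->
  exists N : Q -> Q -> V -> bool, energy h + tau ^+ 4 * eps / 4 * n ^+ 2 <=
    energy (fun x y => h x y - tau / 2 * (N (c x) (c y) x && N (c x) (c y) y)%:R).
Proof.
move=> sml; exists nbr.
have sg := sum_good sml.
have t0 : 0 < tau by rewrite /tau divr_gt0.
have -> : energy (fun x y => h x y - tau / 2 * (R x y)%:R) =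
   energy h + \sum_y \sum_z (R y z)%:R * (tau * (h y z - G y z) - tau ^+ 2 / 4).
  rewrite /energy -big_split; apply: eq_bigr => y _ /=.
  rewrite -big_split; apply: eq_bigr => z _ /=.
  by case: (R y z) => /=; field.
rewrite lerD2l.
have E1 : \sum_y \sum_z (R y z)%:R * (tau * (h y z - G y z) - tau ^+ 2 / 4) =
  \sum_i \sum_j \sum_(y | c y == i) \sum_(z | c z == j)
     (R y z)%:R * (tau * (h y z - G y z) - tau ^+ 2 / 4).
  rewrite (partition_big c predT) //=; apply: eq_bigr => i _.
  by rewrite [RHS]exchange_big /=; apply: eq_bigr => y _; rewrite (partition_big c predT).
rewrite E1.
apply: (@le_trans _ _ (\sum_i \sum_j (tau ^+ 4 / 2) * ((w i j != None)%:R * (a i * a j)))); last first.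
  by apply: ler_sum => i _; apply: ler_sum => j _; exact: block_gain.
have E2 : \sum_i \sum_j (w i j != None)%:R * (a i * a j) =
   \sum_y \sum_z (w (c y) (c z) != None)%:R.
  rewrite [RHS](partition_big c predT) //=; apply: eq_bigr => i _.
  rewrite [RHS](eq_bigr (fun y => \sum_j (w i j != None)%:R * a j)); last first.
    move=> y /eqP cy; rewrite (partition_big c predT) //=.
    apply: eq_bigr => j _; rewrite /a mulr_sumr; apply: eq_bigr => z /eqP cz.
    by rewrite cy cz mulr1.
  rewrite [RHS]exchange_big; apply: eq_bigr => j _ /=.
  by rewrite /a mulr_suml mulr_sumr; apply: eq_bigr => y _; rewrite mul1r.
(* A good triple has its pair [y z] in a block with a witness, and that pair determines the
   triple. *)
have E3 : \sum_x \sum_y \sum_z (good x y z)%:R <= \sum_y \sum_z (w (c y) (c z) != None)%:R :> rat.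
  rewrite exchange_big; apply: ler_sum => y _.
  rewrite exchange_big; apply: ler_sum => z _ /=.
  rewrite /w; case: pickP => [x0 _|none] /=.
    apply: (@le_trans _ _ (\sum_x (tr y z x)%:R)).
      apply: ler_sum => x _; rewrite /good tr12 tr23.
      by case: (tr y z x); case: [&& _ _ & _].
    by rewrite sum_tr3; case/andP: (adj_indicator_bounds y z).
  rewrite big1 // => x _; have := none x; case: (boolP (good x y z)) => // gd.
  move/negbT; rewrite negb_exists => /forallP/(_ y).
  by rewrite negb_exists => /forallP/(_ z); rewrite gd !eqxx.
rewrite (eq_bigr (fun i => (tau ^+ 4 / 2) * \sum_j ((w i j != None)%:R * (a i * a j)))); last first.
  by move=> i _; rewrite mulr_sumr.
rewrite -mulr_sumr E2.
have t4 : 0 < tau ^+ 4 / 2 by rewrite divr_gt0 // exprn_gt0.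
have -> : tau ^+ 4 * eps / 4 * n ^+ 2 = (tau ^+ 4 / 2) * (eps / 2 * n ^+ 2) by field.
by rewrite ler_pM2l //; apply: le_trans sg E3.
Qed.
End Increment.

(** The graph form of the (6,3)-condition: in the graph of pairs that extend to a triple, every edge
    lies in exactly one triangle. *)
Definition triangle_system (V : finType) (tr : V -> V -> V -> bool) :=
  [/\ forall x y z, tr x y z = tr y x z,
      forall x y z, tr x y z = tr x z y,
      forall x y z z', tr x y z -> tr x y z' -> z = z' &
      forall x y z, [exists t, tr x y t] -> [exists t, tr y z t] ->
        [exists t, tr x z t] -> tr x y z].

Lemma energy_increment (eps : rat) (V : finType) (tr : V -> V -> V -> bool)
    (Q : finType) (c : V -> Q) (g : Q -> Q -> rat) :
  0 < eps -> eps <= 1 -> triangle_system tr -> (0 < #|Q|)%N ->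
  eps * #|V|%:R ^+ 2 <= \sum_x \sum_y \sum_z (tr x y z)%:R ->
  4 <= (eps / 12) ^+ 2 * ((eps / 12) * #|V|%:R / #|Q|%:R) ->
  exists (Q' : finType) (c' : V -> Q') (g' : Q' -> Q' -> rat),
    (0 < #|Q'| <= #|Q| * 2 ^ (#|Q| * #|Q|))%N /\
    energy tr (fun x y => g (c x) (c y)) + (eps / 12) ^+ 4 * eps / 4 * #|V|%:R ^+ 2
      <= energy tr (fun x y => g' (c' x) (c' y)).
Proof.
move=> e0 e1 [t12 t23 tu tt] Q0 many nl.
set n := #|V|%:R : rat.
pose S1 : rat := \sum_y \sum_z (g (c y) (c z) < eps / 12)%R%:R * [exists t, tr y z t]%:R.
case: (lerP (3 * (eps / 12) * n ^+ 2) S1) => big.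
  exists Q, c, (fun i j => g i j + (eps / 12) * (g i j < eps / 12)%R%:R); split.
    by rewrite Q0 leq_pmulr // expn_gt0.
  apply: le_trans (energy_raise e0 big); rewrite lerD2l ler_wpM2r ?sqr_ge0 //.
  have t0 : 0 < eps / 12 by rewrite divr_gt0.
  have t1 : eps / 12 <= 1 by lra.
  move: (eps / 12) t0 t1 => t t0 t1.
  have : t ^+ 4 <= t ^+ 2 by rewrite (_ : 4 = 2 + 2)%N // exprD ler_piMl ?exprn_ile1 ?sqr_ge0 // ltW.
  have : t ^+ 4 * eps <= t ^+ 4 by rewrite ler_piMr // exprn_ge0 // ltW.
  by have := exprn_gt0 2 t0; lra.
have [nbr le_e] := energy_refine t12 t23 tu tt e0 many Q0 nl big.
(* The new colour of a vertex is its old colour together with its membership in every set [nbr i j];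
   the lowered function is then again constant on pairs of classes. *)
exists (Q * {ffun Q * Q -> bool})%type, (fun y => (c y, [ffun p => nbr p.1 p.2 y])),
  (fun i j : Q * {ffun Q * Q -> bool} => g i.1 j.1 - (eps / 12) / 2 * (i.2 (i.1, j.1) && j.2 (i.1, j.1))%:R); split.
  by rewrite card_prod card_ffun card_bool card_prod leqnn muln_gt0 Q0 expn_gt0.
apply: le_trans le_e _; rewrite le_eqVlt; apply/orP; left; apply/eqP.
by apply: eq_bigr => x _; apply: eq_bigr => y _; rewrite !ffunE.
Qed.

(* K may grow like a tower, but the gain at each step does not depend on K. *)
Lemma energy_iter (eps : rat) (k : nat) : 0 < eps -> eps <= 1 ->
  exists K n0 : nat, forall (V : finType) (tr : V -> V -> V -> bool),
    triangle_system tr -> (n0 <= #|V|)%N ->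
    eps * #|V|%:R ^+ 2 <= \sum_x \sum_y \sum_z (tr x y z)%:R ->
    exists (Q : finType) (c : V -> Q) (g : Q -> Q -> rat),
    (0 < #|Q| <= K)%N /\
    k%:R * ((eps / 12) ^+ 4 * eps / 4) * #|V|%:R ^+ 2 <= energy tr (fun x y => g (c x) (c y)).
Proof.
move=> e0 e1; elim: k => [|k [K [n0 IH]]].
  exists 1%N, 0%N => V tr _ _ _; exists unit, (fun=> tt), (fun _ _ => 0).
  rewrite card_unit; split=> //; rewrite !mul0r /energy big1 // => x _.
  by rewrite big1 // => y _; rewrite mulr0 mul0r expr0n subr0.
have t0 : 0 < eps / 12 by rewrite divr_gt0.
(* This is the largeness condition of [energy_increment] solved for [#|V|], with [#|Q|] replaced by
   its bound [K]. *)
pose b := 4 * K%:R / (eps / 12) ^+ 3.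
exists (K * 2 ^ (K * K))%N, (maxn n0 (Num.bound b)) => V tr ts.
rewrite geq_max => /andP[n0V bV] many.
have [Q [c [g [/andP[Q0 QK] le_e]]]] := IH V tr ts n0V many.
have Q1 : 0 < #|Q|%:R :> rat by rewrite ltr0n.
case: (@energy_increment eps V tr Q c g) => //.
  have b_lt : b <= #|V|%:R.
    apply/ltW/(lt_le_trans (archi_boundP _)); last by rewrite ler_nat.
    by rewrite /b !mulr_ge0 ?invr_ge0 ?exprn_ge0 // ltW.
  move: b_lt; rewrite /b; move: (eps / 12) t0 => t t0 b_lt.
  rewrite !mulrA -exprSr ler_pdivlMr //.
  apply: (@le_trans _ _ (4 * K%:R)); first by rewrite ler_pM2l // ler_nat.
  by rewrite -ler_pdivrMl ?exprn_gt0 // mulrC.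
move=> Q' [c' [g' [/andP[Q'0 Q'le] le_e']]].
exists Q', c', g'; split.
  rewrite Q'0 (leq_trans Q'le) // leq_mul // leq_exp2l // leq_mul //.
apply: le_trans le_e'; rewrite -natr1 mulrDl mul1r mulrDl lerD2r.
exact: le_e.
Qed.

Theorem ruzsa_szemeredi (eps : rat) : 0 < eps ->
  exists n0 : nat, forall (V : finType) (tr : V -> V -> V -> bool),
    triangle_system tr -> (n0 <= #|V|)%N ->
    \sum_x \sum_y \sum_z (tr x y z)%:R <= eps * #|V|%:R ^+ 2.
Proof.
move=> e0'; pose e := Num.min eps 1.
have e0 : 0 < e by rewrite lt_min e0' ltr01.
have e1 : e <= 1 by rewrite ge_min lexx orbT.
have ee : e <= eps by rewrite ge_min lexx.
pose gam := (e / 12) ^+ 4 * e / 4.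
have g0 : 0 < gam by rewrite divr_gt0 // mulr_gt0 // exprn_gt0 // divr_gt0.
(* After more than [gam^-1] increments of [gam * n ^ 2] the energy would exceed its bound
   [n ^ 2]. *)
have [K [n0 H]] := energy_iter (Num.bound gam^-1) e0 e1.
exists (maxn 1 n0) => V tr ts; rewrite geq_max => /andP[V0 nV].
have n2 : 0 < #|V|%:R ^+ 2 :> rat by rewrite exprn_gt0 // ltr0n.
apply: (@le_trans _ _ (e * #|V|%:R ^+ 2)); last by rewrite ler_wpM2r // ltW.
case: lerP => // /ltW many.
have [Q [c [g [_ le_e]]]] := H V tr ts nV many.
have := le_trans le_e (energy_le tr _); rewrite -/gam.
rewrite -[leRHS]mul1r ler_pM2r // => le1.
have gi0 : 0 <= gam^-1 by rewrite invr_ge0 ltW.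
have lt1 := archi_boundP gi0.
by move: le1; rewrite leNgt -ltr_pdivrMr // mul1r lt1.
Qed.

(** * Triangle-free systems of lines *)

(** Permuting the roles of the sides shows that all three coincide. *)
Definition triangle_free (V : finType) (F : {set {set V}}) :=
  forall A B C x y z, A \in F -> B \in F -> C \in F ->
    x != y -> y != z -> x != z ->
    [set x; y] \subset A -> [set y; z] \subset B -> [set x; z] \subset C -> A = B.

(** A third point of [B] gives a degenerate triangle with sides [A], [B], [B]; so triangle-freeness
    already contains linearity. *)
Lemma triangle_free_eq (V : finType) (F : {set {set V}}) A B x y :
  triangle_free F -> A \in F -> B \in F -> (2 < #|B|)%N -> x != y ->
  [set x; y] \subset A -> [set x; y] \subset B -> A = B.
Proof.
move=> tf AF BF B3 xy sA sB.
have /card_gt0P[z] : (0 < #|B :\: [set x; y]|)%N.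
  by rewrite cardsD (setIidPr sB) cards2 xy subn_gt0.
rewrite !inE negb_or => /andP[/andP[zx zy] zB].
have [xB yB] : x \in B /\ y \in B by move: sB; rewrite subUset !sub1set => /andP[].
apply: (tf A B B x y z) => //; rewrite 1?eq_sym //.
all: by rewrite subUset !sub1set ?xB ?yB ?zB.
Qed.

Lemma cards3 (V : finType) (x y z : V) :
  x != y -> y != z -> x != z -> #|[set x; y; z]| = 3%N.
Proof.
by move=> xy yz xz; rewrite setUC cardsU1 !inE negb_or (eq_sym z) xz (eq_sym z) yz cards2 xy.
Qed.

Lemma card3P (V : finType) (A : {set V}) : #|A| = 3%N ->
  exists x y z, [/\ x != y, y != z, x != z & A = [set x; y; z]].
Proof.
move=> A3; have /card_gt0P[x xA] : (0 < #|A|)%N by rewrite A3.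
move: (cardsD1 x A); rewrite A3 xA add1n => -[] /esym/eqP/cards2P[y [z [yz E]]].
have /setD1P[yx _] : y \in A :\ x by rewrite E !inE eqxx.
have /setD1P[zx _] : z \in A :\ x by rewrite E !inE eqxx orbT.
exists x, y, z; split=> //; try by rewrite eq_sym.
by rewrite -(setD1K xA) E setUA.
Qed.

Lemma triples_le_sum (V : finType) (F : {set {set V}}) :
  (forall A, A \in F -> #|A| = 3%N) -> 
  #|F|%:R <= \sum_x \sum_y \sum_z
    [&& x != y, y != z, x != z & [set x; y; z] \in F]%:R :> rat.
Proof.
move=> F3; pose P (p : V * V * V) := 
  [&& p.1.1 != p.1.2, p.1.2 != p.2, p.1.1 != p.2 & [set p.1.1; p.1.2; p.2] \in F].
have -> : \sum_x \sum_y \sum_z [&& x != y, y != z, x != z & [set x; y; z] \in F]%:R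
   = \sum_p (P p)%:R :> rat.
  by rewrite pair_bigA pair_bigA.
rewrite -natr_sum ler_nat -big_mkcond sum1_card.
apply: leq_trans (leq_imset_card (fun p : V * V * V => [set p.1.1; p.1.2; p.2]) _).
apply: subset_leq_card; apply/subsetP => A AF.
have [x [y [z [xy yz xz E]]]] := card3P (F3 A AF).
by apply/imsetP; exists (x, y, z) => //; rewrite unfold_in /P /= xy yz xz -E AF.
Qed.

Lemma triangle_free_system (V : finType) (F : {set {set V}}) :
  (forall A, A \in F -> #|A| = 3%N) -> triangle_free F ->
  triangle_system (fun x y z => [&& x != y, y != z, x != z & [set x; y; z] \in F]).
Proof.
move=> F3 tf; split.
- move=> x y z; rewrite [[set x; y]]setUC (eq_sym x y).
  by case: (y != x) => //=; rewrite andbCA.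
- move=> x y z; rewrite -setUA [[set y; z]]setUC setUA (eq_sym y z).
  by case: (x == y); case: (z == y); case: (x == z).
- move=> x y z z' /and4P[xy yz xz A] /and4P[_ yz' xz' B].
  have : [set x; y; z] = [set x; y; z'].
    apply: (@triangle_free_eq _ F _ _ x y) => //; rewrite ?F3 //; exact: subsetUl.
  move/setP/(_ z); rewrite !inE eqxx orbT => /esym/orP[/orP[]|] /eqP // E.
    by rewrite E eqxx in xz.
  by rewrite E eqxx in yz.
move=> x y z /existsP[t /and4P[xy yt xt A]] /existsP[u /and4P[yz zu yu B]].
move=> /existsP[v /and4P[xz zv xv C]]; rewrite xy yz xz /=.
have EAB : [set x; y; t] = [set y; z; u].
  by apply: (tf _ _ [set x; z; v] x y z) => //; exact: subsetUl.
suff -> : [set x; y; z] = [set x; y; t] by [].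
apply/eqP; rewrite eqEcard !cards3 // andbT subUset subsetUl sub1set EAB.
by rewrite !inE eqxx orbT.
Qed.

Lemma ex_disjoint_triples (V : finType) (L : {set V}) : exists F : {set {set V}},
  [/\ trivIset F, forall A, A \in F -> A \subset L /\ #|A| = 3%N & (#|L| <= 3 * #|F| + 2)%N].
Proof.
have [m le_m] := ubnP #|L|; elim: m L le_m => // m IH L /ltnSE le_m.
case: (ltnP #|L| 3) => [lt3|ge3].
  exists set0; split; last by rewrite cards0.
    by apply/trivIsetP => A B; rewrite inE.
  by move=> A; rewrite inE.
have [A [AL A3]] : exists A : {set V}, A \subset L /\ #|A| = 3%N.
  have : (0 < #|[set A : {set V} | A \subset L & #|A| == 3]|)%N.
    by rewrite cards_draws bin_gt0.
  by case/card_gt0P => A; rewrite inE => /andP[? /eqP ?]; exists A.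
have cD : #|L :\: A| = (#|L| - 3)%N by rewrite cardsD (setIidPr AL) A3.
case: (IH (L :\: A)) => [|F [tF subF leF]]; first by rewrite cD; lia.
have dis B : B \in F -> [disjoint A & B].
  by case/subF => sB _; rewrite disjoint_sym; apply/setDidPl/eqP; 
     rewrite eqEsubset subsetDl subsetD subxx disjoints_subset (subset_trans sB) // subsetDr.
have AF : A \notin F.
  by apply/negP => /dis; rewrite -setI_eq0 setIid -cards_eq0 A3.
exists (A |: F); split.
- apply/trivIsetP => B C; rewrite !inE => /orP[/eqP->|BF] /orP[/eqP->|CF].
  + by rewrite eqxx.
  + by move=> _; exact: dis.
  + by move=> _; rewrite disjoint_sym; exact: dis.
  + by move/trivIsetP: tF; apply.
- move=> B; rewrite !inE => /orP[/eqP->|/subF[sB B3]] //; split=> //.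
  exact: subset_trans sB (subsetDl _ _).
- by rewrite cardsU1 AF; lia.
Qed.

(** Each line is cut into disjoint triples, to which the theorem on triples applies. A line of size
    at least 3 with [t] triples has [t >= 1] and size at most [3 * t + 2], hence at most [5 * t];
    this is the 5 in the density. *)
Theorem sum_lines_small (d : nat) : exists n0 : nat, forall (V : finType) (F : {set {set V}}),
  (forall L, L \in F -> (2 < #|L|)%N) -> triangle_free F -> (n0 <= #|V|)%N ->
  (d * \sum_(L in F) #|L| <= #|V| ^ 2)%N.
Proof.
have pos : 0 < (5 * d.+1%:R)^-1 :> rat by rewrite invr_gt0 mulr_gt0 ?ltr0n.
have [n0 H] := ruzsa_szemeredi pos.
exists n0 => V F F3 tf nV.
have /fin_all_exists[D DP] := @ex_disjoint_triples V.
pose T := \bigcup_(L in F) D L.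
have inT A : A \in T -> exists2 L, L \in F & A \in D L by case/bigcupP => L; exists L.
have T3 A : A \in T -> #|A| = 3%N.
  by case/inT => L LF AL; case: (DP L) => _ /(_ A AL)[].
have tfT : triangle_free T.
  move=> A B C x y z /inT[LA LAF AD] /inT[LB LBF BD] /inT[LC LCF CD] xy yz xz sA sB sC.
  have [tA subA _] := DP LA; have [tB subB _] := DP LB; have [tC subC _] := DP LC.
  have [sA' _] := subA _ AD; have [sB' _] := subB _ BD; have [sC' _] := subC _ CD.
  have E1 : LA = LB.
    by apply: (tf LA LB LC x y z) => //; apply: subset_trans; eassumption.
  have yA : y \in A by move: sA; rewrite subUset !sub1set => /andP[].
  have yB : y \in B by move: sB; rewrite subUset !sub1set => /andP[].
  (* Both triples now come from one line, where distinct triples are disjoint, yet they share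
     [y]. *)
  apply/eqP; apply: contraT => AB.
  rewrite E1 in AD; move/trivIsetP: tB => /(_ A B AD BD AB).
  by move/pred0P/(_ y) => /=; rewrite yA yB.
have cT : (\sum_(L in F) #|D L| <= #|T|)%N.
  pose S := [set p : {set V} * {set V} | (p.1 \in F) && (p.2 \in D p.1)].
  have -> : (\sum_(L in F) #|D L| = #|S|)%N.
    rewrite (eq_bigr (fun L => \sum_(A in D L) 1)%N); last by move=> L _; rewrite sum1_card.
    by rewrite pair_big_dep /= -sum1_card; apply: eq_bigl => p; rewrite inE.
  have inj : {in S &, injective (fun p => p.2)}.
    move=> [L A] [M B]; rewrite !inE /= => /andP[LF AL] /andP[MF BM] E; subst B.
    congr pair; have A3 : #|A| = 3%N by apply: T3; apply/bigcupP; exists L.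
    have [x [y [z [xy yz xz EA]]]] := card3P A3.
      have [_ /(_ _ AL)[sL _] _] := DP L; have [_ /(_ _ BM)[sM _] _] := DP M.
    apply: (@triangle_free_eq _ F _ _ x y) => //; first exact: F3.
      by apply: subset_trans sL; rewrite EA subsetUl.
    by apply: subset_trans sM; rewrite EA subsetUl.
  rewrite -(card_in_imset inj); apply: subset_leq_card; apply/subsetP => A /imsetP[[L B]].
  by rewrite inE => /andP[LF AL] ->; apply/bigcupP; exists L.
have leL : (\sum_(L in F) #|L| <= 5 * #|T|)%N.
  apply: (@leq_trans (5 * \sum_(L in F) #|D L|)); last by rewrite leq_mul2l cT orbT.
  rewrite big_distrr /=; apply: leq_sum => L LF.
  have [_ _] := DP L; have := F3 _ LF.
  move: #|L| #|D L| => p q; lia.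
have := le_trans (triples_le_sum T3) (H V _ (triangle_free_system T3 tfT) nV).
rewrite mulrC ler_pdivlMr ?mulr_gt0 ?ltr0n // -natrX -!natrM ler_nat => le2.
by nia.
Qed.

(** * Rank-three matroids without W^3 and M(K_4) *)

Local Close Scope ring_scope.

Section MatroidBasics.
Variables (T : finType) (J : {set {set T}}).
Hypothesis mJ : is_matroid J.

Lemma indep0 : set0 \in J.
Proof. by case/and3P: mJ. Qed.

Lemma indepS (X Y : {set T}) : X \subset Y -> Y \in J -> X \in J.
Proof.
move=> sXY YJ; case/and3P: mJ => _ /forallP/(_ Y)/forallP/(_ X) + _.
by rewrite YJ sXY => /implyP; apply.
Qed.

Lemma indep_augment (Y Z : {set T}) : Y \in J -> Z \in J -> #|Y| < #|Z| ->
  exists z, [/\ z \in Z, z \notin Y & z |: Y \in J].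
Proof.
move=> YJ ZJ lt; case/and3P: mJ => _ _ /forallP/(_ Y)/forallP/(_ Z).
rewrite YJ ZJ lt => /implyP/(_ isT)/existsP[z /andP[]].
by rewrite inE => /andP[]; exists z.
Qed.
End MatroidBasics.

Definition restriction_iso (T : finType) (J : {set {set T}}) (k : nat)
    (N : {set {set 'I_k}}) :=
  exists2 f : 'I_k -> T, injective f & forall S, (S \in N) = (f @: S \in J).

(* Positions of the six elements a, ..., f on the three lines abc, cde, efa, and on bdf. *)
Definition on_line (l i : nat) : bool :=
  i \in nth [::] [:: [:: 0; 1; 2]; [:: 2; 3; 4]; [:: 4; 5; 0]; [:: 1; 3; 5]] l.

Definition on_count (l i j k : nat) : nat := on_line l i + on_line l j + on_line l k.

(** The three lines decide every triple but [bdf]: a line with exactly two of the points makes the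
    triple independent, one with all three makes it dependent. *)
Lemma on_count_cases i j k : i < 6 -> j < 6 -> k < 6 -> i != j -> j != k -> i != k ->
  [|| has (fun l => on_count l i j k == 2) [:: 0; 1; 2]
        && ~~ has (fun l => on_count l i j k == 3) [:: 0; 1; 2; 3],
      has (fun l => on_count l i j k == 3) [:: 0; 1; 2] |
      (on_count 3 i j k == 3) && ~~ has (fun l => on_count l i j k == 3) [:: 0; 1; 2]].
Proof.
pose c i j k := [&& i != j, j != k & i != k] ==>
  [|| has (fun l => on_count l i j k == 2) [:: 0; 1; 2]
        && ~~ has (fun l => on_count l i j k == 3) [:: 0; 1; 2; 3],
      has (fun l => on_count l i j k == 3) [:: 0; 1; 2] |
      (on_count 3 i j k == 3) && ~~ has (fun l => on_count l i j k == 3) [:: 0; 1; 2]].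
have c_all : all (fun i => all (fun j => all (c i j) (iota 0 6)) (iota 0 6)) (iota 0 6).
  by vm_compute.
move=> i6 j6 k6 ij jk ik.
have := allP (allP (allP c_all i _) j _) k; rewrite !mem_iota => /(_ i6 j6 k6)/implyP; apply.
by rewrite ij jk ik.
Qed.

Section RankThree.
Variables (T : finType) (J : {set {set T}}).
Hypothesis mJ : is_matroid J.

Definition parallel x y :=
  [&& [set x] \in J, [set y] \in J & (x == y) || ([set x; y] \notin J)].

Lemma parallel_sym x y : parallel x y = parallel y x.
Proof. by rewrite /parallel setUC eq_sym; case: ([set x] \in J); case: ([set y] \in J). Qed.

Lemma parallel_trans x y z : parallel x y -> parallel y z -> parallel x z.
Proof.
move=> /and3P[xJ yJ xy] /and3P[_ zJ yz]; apply/and3P; split=> //.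
case: eqVneq => //= xz; apply/negP => xzJ.
have [|u [uxz uy uyJ]] := indep_augment mJ yJ xzJ; first by rewrite cards1 cards2 xz.
move: uxz uy uyJ; rewrite !inE => /orP[]/eqP-> ne uyJ.
  by move: xy; rewrite (negbTE ne) uyJ.
by move: yz; rewrite eq_sym (negbTE ne) setUC uyJ.
Qed.

(** Loops get [None]. The [pick] depends only on the predicate, so parallel elements share their
    representative. *)
Definition rep x := if [set x] \in J then [pick y | parallel x y] else None.

Definition is_rep x := rep x == Some x.

Lemma rep_parallel x y : parallel x y -> rep x = rep y.
Proof.
move=> pxy; have /and3P[xJ yJ _] := pxy; rewrite /rep xJ yJ; apply: eq_pick => z.
apply/idP/idP; last exact: parallel_trans.
by apply: parallel_trans; rewrite parallel_sym.
Qed.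

Lemma rep_some x : [set x] \in J -> exists y, [/\ rep x = Some y, parallel x y & is_rep y].
Proof.
move=> xJ; have pxx : parallel x x by rewrite /parallel xJ eqxx.
suff [y [rx pxy]] : exists y, rep x = Some y /\ parallel x y.
  by exists y; split=> //; rewrite /is_rep -(rep_parallel pxy) rx.
by rewrite /rep xJ; case: pickP => [y pxy|/(_ x)]; [exists y | rewrite pxx].
Qed.

Lemma is_rep_indep x : is_rep x -> [set x] \in J.
Proof. by rewrite /is_rep /rep; case: ifP. Qed.

Lemma is_rep_indep2 x y : is_rep x -> is_rep y -> x != y -> [set x; y] \in J.
Proof.
move=> rx ry; apply: contraNT => xyJ.
have : rep x = rep y.
  by apply: rep_parallel; rewrite /parallel !is_rep_indep //= xyJ orbT.
by rewrite (eqP rx) (eqP ry) => -[->].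
Qed.

(** Restricted to representatives, these are the rank-2 flats of the simplification, in which any
    two points are independent. *)
Definition line x y := 
  [set v | is_rep v && [|| v == x, v == y | [set x; y; v] \notin J]].

Lemma line_l x y : is_rep x -> x \in line x y.
Proof. by move=> rx; rewrite inE rx eqxx. Qed.

Lemma line_r x y : is_rep y -> y \in line x y.
Proof. by move=> ry; rewrite inE ry eqxx orbT. Qed.

Lemma line_rank2 x y (Z : {set T}) : is_rep x -> is_rep y -> x != y ->
  Z \subset line x y -> Z \in J -> #|Z| <= 2.
Proof.
move=> rx ry xy sZ ZJ; rewrite leqNgt; apply/negP => lt.
have [|z [zZ zxy zJ]] := indep_augment mJ (is_rep_indep2 rx ry xy) ZJ.
  by rewrite cards2 xy.
move: (subsetP sZ z zZ) zxy; rewrite !inE negb_or => /andP[_ zl] /andP[zx zy].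
by move: zl; rewrite (negbTE zx) (negbTE zy) setUC zJ.
Qed.

Lemma line_sub x y z w : is_rep x -> is_rep y -> x != y ->
  z \in line x y -> w \in line x y -> z != w -> line x y \subset line z w.
Proof.
move=> rx ry xy zL wL zw; apply/subsetP => u uL.
rewrite inE; have -> /= : is_rep u by move: uL; rewrite inE => /andP[].
case: eqVneq => //= uz; case: eqVneq => //= uw; apply/negP => zwuJ.
have := line_rank2 rx ry xy _ zwuJ; rewrite !subUset !sub1set zL wL uL => /(_ isT).
by rewrite cards3 // 1?eq_sym // eq_sym.
Qed.

Lemma line_eq x y z w : is_rep x -> is_rep y -> x != y ->
  z \in line x y -> w \in line x y -> z != w -> line z w = line x y.
Proof.
move=> rx ry xy zL wL zw; have s1 := line_sub rx ry xy zL wL zw.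
apply/eqP; rewrite eqEsubset s1 andbT; apply: line_sub => //.
- by move: zL; rewrite inE => /andP[].
- by move: wL; rewrite inE => /andP[].
- exact: (subsetP s1) (line_l y rx).
- exact: (subsetP s1) (line_r x ry).
Qed.

Definition long_lines :=
  [set line p.1 p.2 | p in [set p : T * T |
     [&& is_rep p.1, is_rep p.2, p.1 != p.2 & 2 < #|line p.1 p.2|]]].

Lemma long_lineP L : L \in long_lines -> 2 < #|L| /\
  forall x y, x \in L -> y \in L -> x != y -> [/\ is_rep x, is_rep y & L = line x y].
Proof.
case/imsetP => -[p q]; rewrite inE /= => /and4P[rp rq pq cL] ->; split=> // x y xL yL xy.
rewrite (line_eq rp rq pq xL yL xy).
by move: xL yL; rewrite !inE => /andP[-> _] /andP[-> _].
Qed.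

Lemma long_line_rep L x : L \in long_lines -> x \in L -> is_rep x.
Proof. by case/imsetP => p _ ->; rewrite inE => /andP[]. Qed.

Lemma long_line_meet L M x y : L \in long_lines -> M \in long_lines ->
  x \in L -> y \in L -> x \in M -> y \in M -> x != y -> L = M.
Proof.
move=> /long_lineP[_ LP] /long_lineP[_ MP] xL yL xM yM xy.
by have [_ _ ->] := LP x y xL yL xy; have [_ _ ->] := MP x y xM yM xy.
Qed.

Lemma long_line_dep L x y z : L \in long_lines -> x \in L -> y \in L -> z \in L ->
  x != y -> y != z -> x != z -> [set x; y; z] \notin J.
Proof.
move=> /long_lineP[_ LP] xL yL zL xy yz xz.
have [_ _ E] := LP x y xL yL xy; move: zL; rewrite E inE => /andP[_].
by rewrite eq_sym (negbTE xz) eq_sym (negbTE yz).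
Qed.

Lemma long_line_indep L x y z : L \in long_lines -> x \in L -> y \in L -> z \notin L ->
  is_rep z -> x != y -> [set x; y; z] \in J.
Proof.
move=> /long_lineP[_ LP] xL yL zL rz xy.
have [_ _ E] := LP x y xL yL xy; move: zL; rewrite E inE rz /= !negb_or.
by case/and3P => _ _; rewrite negbK.
Qed.

Section Configuration.
Variables (f : 'I_6 -> T) (L : nat -> {set T}).
Hypothesis L_long : forall l, l < 3 -> L l \in long_lines.
Hypothesis f_on : forall l (i : 'I_6), l < 3 -> (f i \in L l) = on_line l i.
Hypothesis J3 : forall X, X \in J -> #|X| <= 3.

(** The six positions have pairwise different incidences with the three lines. *)
Lemma config_inj : injective f.
Proof.
move=> i j E; have H l : l < 3 -> on_line l i = on_line l j by move=> l3; rewrite -!f_on ?E.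
apply: val_inj; move: (H 0 isT) (H 1 isT) (H 2 isT) => /=.
have : all (fun i => all (fun j => [&& on_line 0 i == on_line 0 j, on_line 1 i == on_line 1 j
    & on_line 2 i == on_line 2 j] ==> (i == j)) (iota 0 6)) (iota 0 6) by vm_compute.
move=> /allP/(_ i); rewrite mem_iota => /(_ (ltn_ord i))/allP/(_ j).
rewrite mem_iota => /(_ (ltn_ord j))/implyP + H0 H1 H2.
by rewrite H0 H1 H2 !eqxx => /(_ isT)/eqP.
Qed.

Lemma config_rep i : is_rep (f i).
Proof.
have : all (fun i => has (fun l => on_line l i) [:: 0; 1; 2]) (iota 0 6) by vm_compute.
move=> /allP/(_ i); rewrite mem_iota => /(_ (ltn_ord i))/hasP[l].
rewrite !inE => /or3P[]/eqP-> on.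
- by apply: (long_line_rep (L_long (isT : 0 < 3))); rewrite f_on.
- by apply: (long_line_rep (L_long (isT : 1 < 3))); rewrite f_on.
- by apply: (long_line_rep (L_long (isT : 2 < 3))); rewrite f_on.
Qed.

Definition config_dep (b : bool) (i j k : 'I_6) :=
  has (fun l => on_count l i j k == 3) [:: 0; 1; 2] || (b && (on_count 3 i j k == 3)).

Lemma on_count3 l i j k : (on_count l i j k == 3) = [&& on_line l i, on_line l j & on_line l k].
Proof. by rewrite /on_count; do 3!case: on_line. Qed.

Lemma set3_eq (i j k p q r : 'I_6) : i != j -> j != k -> i != k ->
  p != q -> q != r -> p != r ->
  ([set i; j; k] == [set p; q; r]) =
  [&& i \in [set p; q; r], j \in [set p; q; r] & k \in [set p; q; r]].
Proof.
move=> *; rewrite eqEcard !cards3 // andbT !subUset !sub1set; exact/esym/andbA.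
Qed.

Let bdf := f @: [set ib; id_; iff_].

(** Only the status of [bdf] is left open by the lines; it is the bit that separates W^3 from
    M(K_4), so one of the two always appears. *)
Lemma config_triple i j k : i != j -> j != k -> i != k ->
  ([set f i; f j; f k] \in J) = ~~ config_dep (bdf \notin J) i j k.
Proof.
move=> ij jk ik.
have fij : f i != f j by apply: contra ij => /eqP/config_inj->.
have fjk : f j != f k by apply: contra jk => /eqP/config_inj->.
have fik : f i != f k by apply: contra ik => /eqP/config_inj->.
have := on_count_cases (ltn_ord i) (ltn_ord j) (ltn_ord k) ij jk ik.
have lt3 l : l \in [:: 0; 1; 2] -> l < 3 by rewrite !inE => /or3P[]/eqP->.
case/or3P => [/andP[/hasP[l /lt3 l3 c2] no3]|c3|/andP[c3 no3]].
- have -> : config_dep (bdf \notin J) i j k = false.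
    apply/negbTE; move: no3; apply: contra; rewrite /config_dep /=.
    by case/orP => [/or4P[]|/andP[_]] ->; rewrite ?orbT.
  have LL := L_long l3.
  move: c2; rewrite /on_count -!f_on //.
  case fi : (f i \in _); case fj : (f j \in _); case fk : (f k \in _) => // _.
  + by apply: (long_line_indep LL); rewrite ?fk ?config_rep.
  + by rewrite -setUA [[set f j; _]]setUC setUA; apply: (long_line_indep LL); rewrite ?fj ?config_rep.
  + by rewrite -setUA setUC; apply: (long_line_indep LL); rewrite ?fi ?config_rep.
- rewrite /config_dep c3; case/hasP: c3 => l /lt3 l3.
  rewrite on_count3 -!f_on // => /and3P[fi fj fk].
  exact/negbTE/(long_line_dep (L_long l3)).
- rewrite /config_dep (negbTE no3) c3 andbT /= negbK.
  suff -> : bdf = [set f i; f j; f k] by [].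
  rewrite /bdf; have <- : [set i; j; k] = [set ib; id_; iff_].
    apply/eqP; rewrite set3_eq //; move: c3; rewrite on_count3.
    by rewrite /on_line /= !inE -!val_eqE /= -!orbA.
  by rewrite !imsetU !imset_set1.
Qed.

Lemma config_minor : restriction_iso J W3 \/ restriction_iso J MK4.
Proof.
pose N := if bdf \in J then W3 else MK4.
suff H S : (S \in N) = (f @: S \in J).
  by move: H; rewrite /N; case: ifP => _ H; [left|right]; exists f => //; exact: config_inj.
have [le2|] := leqP #|S| 2.
  have -> : S \in N.
    have ne (A : {set 'I_6}) : #|A| = 3 -> S != A by move=> A3; apply: contraTneq le2 => ->; rewrite A3.
    rewrite /N; case: ifP => _; rewrite inE (leq_trans le2) //= !ne ?cards3 //.
  apply/esym; have : #|f @: S| <= 2 by rewrite card_imset //; exact: config_inj.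
  have repS x : x \in f @: S -> is_rep x by case/imsetP => i _ ->; exact: config_rep.
  rewrite leq_eqVlt => /orP[/cards2P[x [y [xy E]]]|].
    by rewrite E is_rep_indep2 // repS // E !inE eqxx ?orbT.
  rewrite ltnS leq_eqVlt => /orP[/cards1P[x E]|].
    by rewrite E is_rep_indep // repS // E inE.
  by rewrite ltnS leqn0 cards_eq0 => /eqP->; exact: indep0.
rewrite leq_eqVlt => /orP[/eqP/esym S3|lt3]; last first.
  have -> : (S \in N) = false.
    by rewrite /N; case: ifP => _; rewrite inE leqNgt lt3.
  apply/esym/negbTE; apply: contraL lt3 => /J3; rewrite card_imset; last exact: config_inj.
  by rewrite -leqNgt.
have [i [j [k [ij jk ik E]]]] := card3P S3.
rewrite E !imsetU !imset_set1 config_triple //.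
rewrite /N; case: (bdf \in J); rewrite inE cards3 //= !set3_eq //= /config_dep /= !on_count3.
  by rewrite /= !orbF !negb_or /on_line /= !inE -!val_eqE /= -!orbA.
by rewrite /= !orbF -!orbA !negb_or /on_line /= !inE -!val_eqE /= -!orbA.
Qed.
End Configuration.

Hypothesis J3 : forall X, X \in J -> #|X| <= 3.
Hypothesis noW3 : ~ restriction_iso J W3.
Hypothesis noMK4 : ~ restriction_iso J MK4.

Lemma long_line_third L x y : L \in long_lines -> exists z, [/\ z \in L, z != x & z != y].
Proof.
case/long_lineP => L3 _; have /card_gt0P[z] : 0 < #|L :\: [set x; y]|.
  rewrite cardsD subn_gt0; apply: leq_ltn_trans L3.
  apply: leq_trans (subset_leq_card (subsetIr _ _)) _.
  by rewrite cards2; case: (x != y).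
by rewrite !inE negb_or => /andP[/andP[zx zy] zL]; exists z.
Qed.

Lemma long_lines_triangle_free : triangle_free long_lines.
Proof.
move=> A B C x y z AL BL CL xy yz xz.
rewrite !subUset !sub1set => /andP[xA yA] /andP[yB zB] /andP[xC zC].
apply/eqP; apply: contraT => /eqP AB.
have ne : A != C by apply/eqP => EAC; apply: AB;
  apply: (long_line_meet AL BL (x := y) (y := z)) => //; rewrite EAC.
have ne' : B != C by apply/eqP => EBC; apply: AB;
  apply: (long_line_meet AL BL (x := x) (y := y)) => //; rewrite EBC.
have [b [bA bx b_y]] := long_line_third x y AL.
have [d [dB dy dz]] := long_line_third y z BL.
(* The corners [x], [y], [z] take the positions a, c, e, and the third points [b], [d], [e] of the
   sides take b, d, f. *)
have [e [eC ez ex]] := long_line_third z x CL.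
pose f (i : 'I_6) := nth x [:: x; b; y; d; z; e] i.
pose L l := nth A [:: A; B; C] l.
have meetAB u v : u \in A -> v \in A -> u \in B -> v \in B -> u = v.
  by move=> uA vA uB vB; apply/eqP; apply: contraT => uv; case: AB; 
     apply: (long_line_meet AL BL (x := u) (y := v)).
have meetAC u v : u \in A -> v \in A -> u \in C -> v \in C -> u = v.
  by move=> uA vA uB vB; apply/eqP; apply: contraT => uv; case/eqP: ne; 
     apply: (long_line_meet AL CL (x := u) (y := v)).
have meetBC u v : u \in B -> v \in B -> u \in C -> v \in C -> u = v.
  by move=> uA vA uB vB; apply/eqP; apply: contraT => uv; case/eqP: ne'; 
     apply: (long_line_meet BL CL (x := u) (y := v)).
have xB : x \notin B by apply: contra xy => xB; apply/eqP; exact: meetAB.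
have yC : y \notin C by apply: contra xy => yC; apply/eqP; exact: meetAC.
have zA : z \notin A by apply: contra yz => zA; apply/eqP; exact: meetAB.
have bB : b \notin B by apply: contra b_y => bB; apply/eqP; exact: meetAB.
have bC : b \notin C by apply: contra bx => bC; apply/eqP; exact: meetAC.
have dA : d \notin A by apply: contra dy => dA; apply/eqP; exact: meetAB.
have dC : d \notin C by apply: contra dz => dC; apply/eqP; exact: meetBC.
have eA : e \notin A by apply: contra ex => eA; apply/eqP; exact: meetAC.
have eB : e \notin B by apply: contra ez => eB; apply/eqP; exact: meetBC.
have [||//|//] := @config_minor f L _ _ J3.
  by move=> [|[|[|//]]] _.
move=> [|[|[|//]]] [[|[|[|[|[|[|//]]]]]] i6] _; rewrite /f /L /on_line /=;
  by [|apply/negbTE].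
Qed.

(* Joining two points of each long line L to all of L takes 2|L| pairs and determines L:
   triangle-freeness forces every triangle of such pairs to lie inside a single line. *)
Definition pts (L : {set T}) := [set x in take 2 (enum L)].

Lemma ptsP (L : {set T}) : 2 < #|L| -> exists p q, [/\ p != q, p \in L, q \in L & pts L = [set p; q]].
Proof.
rewrite cardE /pts; have := enum_uniq L; have := mem_enum L.
case: (enum L) => [|p [|q s]] //= memL /andP[pqs _] _; exists p, q; split.
- by move: pqs; rewrite inE negb_or => /andP[].
- by rewrite -memL !inE eqxx.
- by rewrite -memL !inE eqxx orbT.
- by apply/setP => x; rewrite take0 !inE.
Qed.

Definition line_code : {set T * T} :=
  [set p | [exists L in long_lines, (p.1 \in pts L) && (p.2 \in L)]].

Lemma card_line_code : #|line_code| <= 2 * \sum_(L in long_lines) #|L|.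
Proof.
have -> : line_code = \bigcup_(L in long_lines) setX (pts L) L.
  apply/setP => -[u v]; rewrite inE; apply/existsP/bigcupP => /= -[L].
    by case/andP => LL uv; exists L; rewrite // in_setX.
  by rewrite in_setX => LL uv; exists L; rewrite LL.
have : #|\bigcup_(L in long_lines) setX (pts L) L| <= \sum_(L in long_lines) #|setX (pts L) L|.
  elim/big_rec2: _ => [|L m U _ le]; first by rewrite cards0.
  by rewrite cardsU; apply: leq_trans (leq_subr _ _) _; rewrite leq_add2l.
move=> /leq_trans; apply; rewrite big_distrr /=; apply: leq_sum => L LL.
have [/ptsP[p [q [pq _ _ ->]]] _] := long_lineP LL.
by rewrite cardsX cards2 pq.
Qed.
End RankThree.

(** Letting [s] range over [p] and [q] too puts [(q, p)] in [E], so the pair [p], [q] itself is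
    known to lie on a line. *)
Definition decode_dep (T : finType) (E : {set T * T}) u v w :=
  [exists p, exists q, (p != q) && [forall s in [set u; v; w; p; q], ((p, s) \in E) && ((q, s) \in E)]].

Section Decoding.
Variables (T : finType) (J : {set {set T}}).
Hypothesis mJ : is_matroid J.
Hypothesis J3 : forall X, X \in J -> #|X| <= 3.
Hypothesis noW3 : ~ restriction_iso J W3.
Hypothesis noMK4 : ~ restriction_iso J MK4.

Lemma line_codeP p s : reflect (exists2 L, L \in long_lines J & p \in pts L /\ s \in L)
  ((p, s) \in line_code J).
Proof.
by rewrite inE; apply: (iffP exists_inP) => -[L LL]; [case/andP|case] => a b; exists L => //=; rewrite a.
Qed.

Lemma pts_sub (L : {set T}) p : p \in pts L -> p \in L.
Proof. by rewrite inE => /mem_take; rewrite mem_enum. Qed.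

(** The code does not say which line a pair came from: [(p, s)] and [(q, s)] may stem from different
    lines. Together with a line through [p] and [q] these form a triangle, so triangle-freeness puts
    [s] on that line. *)
Lemma line_code_decode u v w : is_rep J u -> is_rep J v -> is_rep J w ->
  u != v -> v != w -> u != w ->
  decode_dep (line_code J) u v w = ([set u; v; w] \notin J).
Proof.
move=> ru rv rw uv vw uw; apply/idP/idP => [|dep].
  case/existsP => p /existsP[q /andP[pq /forall_inP H]].
  have inS s : s \in [set u; v; w] -> s \in [set u; v; w; p; q].
    by rewrite !inE => /orP[/orP[]|] ->; rewrite ?orbT.
  have /H/andP[_ /line_codeP[L LL [qL' pL]]] : p \in [set u; v; w; p; q] by rewrite !inE eqxx !orbT.
  have qL := pts_sub qL'.
  have key s : s \in [set u; v; w] -> s \in L.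
    move=> /inS/H/andP[/line_codeP[M ML [/pts_sub pM sM]] /line_codeP[N NL [/pts_sub qN sN]]].
    case: (eqVneq s p) => [->//|sp]; case: (eqVneq s q) => [->//|sq].
    rewrite (_ : L = N) //.
    by apply: (long_lines_triangle_free mJ J3 noW3 noMK4 (x := p) (y := q) (z := s) LL NL ML);
       rewrite ?subUset ?sub1set ?pL ?qL ?qN ?sN ?pM ?sM // eq_sym.
  by apply: (long_line_dep mJ LL) => //; apply: key; rewrite !inE eqxx ?orbT.
have uL := line_l v ru; have vL := line_r u rv.
have wL : w \in line J u v by rewrite inE rw dep !orbT.
have LL : line J u v \in long_lines J.
  apply/imsetP; exists (u, v) => //; rewrite inE /= ru rv uv /=.
  apply: (@leq_trans #|[set u; v; w]|); first by rewrite cards3.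
  by apply: subset_leq_card; rewrite !subUset !sub1set uL vL wL.
have [/ptsP[p [q [pq pL qL E]]] _] := long_lineP mJ LL.
apply/existsP; exists p; apply/existsP; exists q; rewrite pq; apply/forall_inP => s sS.
have sL : s \in line J u v.
  have : [set u; v; w; p; q] \subset line J u v by rewrite !subUset !sub1set uL vL wL pL qL.
  by move/subsetP; apply.
by apply/andP; split; apply/line_codeP; exists (line J u v) => //;
  split; rewrite // E !inE eqxx ?orbT.
Qed.

(** Augmenting [{x'}] twice from [{x, y, z}] can never add [x], which is dependent with [x'], so it
    adds [y] and [z]. *)
Lemma parallel_subst x x' y z : parallel J x x' -> x != y -> y != z -> x != z ->
  [set x; y; z] \in J -> [/\ x' != y, x' != z & [set x'; y; z] \in J].
Proof.
move=> par xy yz xz X; have /and3P[xJ x'J /orP[/eqP<- //|xx']] := par.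
have [|u [uX ux' uJ]] := indep_augment mJ x'J X; first by rewrite cards1 cards3.
have [|v [vX vu vJ]] := indep_augment mJ uJ X.
  by rewrite cardsU1 ux' cards1 cards3.
have nx (t : {set T}) : x \in t -> x' \in t -> t \notin J.
  move=> xt x't; apply: contra xx' => tJ; apply: (indepS mJ _ tJ).
  by rewrite subUset !sub1set xt.
have ux : u != x by apply: contraTneq uJ => ->; apply: nx; rewrite !inE eqxx ?orbT.
have vx : v != x by apply: contraTneq vJ => ->; apply: nx; rewrite !inE eqxx ?orbT.
move: uX vX ux' vu vJ; rewrite !inE (negbTE ux) (negbTE vx) /= !negb_or => uX vX ux' /andP[vu vx'] vJ.
have E : [set x'; y; z] = v |: (u |: [set x']).
  by case/orP: uX vX vu => /eqP-> /orP[]/eqP->; rewrite ?eqxx // => _;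
     apply/setP => t; rewrite !inE; case: (t == x'); case: (t == y); case: (t == z).
rewrite E vJ; split=> //.
- by case/orP: uX vX vu ux' vx' => /eqP-> /orP[]/eqP->; rewrite ?eqxx // => _ *; rewrite eq_sym.
- by case/orP: uX vX vu ux' vx' => /eqP-> /orP[]/eqP->; rewrite ?eqxx // => _ *; rewrite eq_sym.
Qed.

Lemma set3_rot (x y z : T) : [set x; y; z] = [set y; z; x].
Proof. by rewrite -setUA setUC. Qed.

Lemma parallel_triple x y z p q s : parallel J x p -> parallel J y q -> parallel J z s ->
  x != y -> y != z -> x != z -> [set x; y; z] \in J ->
  [/\ p != q, q != s, p != s & [set p; q; s] \in J].
Proof.
move=> xp yq zs xy yz xz XJ.
have [py pz] := parallel_subst xp xy yz xz XJ; rewrite set3_rot => XJ1.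
have [||| qz qp] := parallel_subst yq _ _ _ XJ1; rewrite // 1?eq_sym //.
rewrite set3_rot => XJ2.
have [||| sp sq] := parallel_subst zs _ _ _ XJ2; rewrite // 1?eq_sym //.
by rewrite set3_rot => XJ3; split; rewrite // eq_sym.
Qed.

Definition code := ([ffun x => rep J x], line_code J).

Lemma triple_decode x y z : x != y -> y != z -> x != z ->
  ([set x; y; z] \in J) =
  if (code.1 x, code.1 y, code.1 z) is (Some p, Some q, Some s) then
    [&& p != q, q != s, p != s & ~~ decode_dep code.2 p q s] else false.
Proof.
move=> xy yz xz; rewrite !ffunE /=.
have loop t : t \in [set x; y; z] -> rep J t = None -> [set x; y; z] \notin J.
  move=> tX rt; apply/negP => XJ; have : [set t] \in J by apply: indepS XJ => //; rewrite sub1set.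
  by case/(rep_some mJ) => t' []; rewrite rt.
have inJ t u : rep J t = Some u -> parallel J t u /\ is_rep J u.
  rewrite {1}/rep; case: ifP => // tJ E; have [u' [E' ? ?]] := rep_some mJ tJ.
  by move: E'; rewrite /rep tJ E => -[->].
case rx : (rep J x) => [p|]; last by apply/negbTE/(loop x) => //; rewrite !inE eqxx.
case ry : (rep J y) => [q|]; last by apply/negbTE/(loop y) => //; rewrite !inE eqxx orbT.
case rz : (rep J z) => [s|]; last by apply/negbTE/(loop z) => //; rewrite !inE eqxx !orbT.
have [pxp rp] := inJ _ _ rx; have [pyq rq] := inJ _ _ ry; have [pzs rs] := inJ _ _ rz.
apply/idP/idP => [XJ|/and4P[pq qs ps]].
  have [pq qs ps XJ'] := parallel_triple pxp pyq pzs xy yz xz XJ.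
  by rewrite pq qs ps line_code_decode // negbK.
rewrite line_code_decode // negbK => XJ.
have [px qy sz] : [/\ parallel J p x, parallel J q y & parallel J s z].
  by split; rewrite parallel_sym.
by have [] := parallel_triple px qy sz pq qs ps XJ.
Qed.
End Decoding.

Definition triples (T : finType) (J : {set {set T}}) := [set X in J | #|X| == 3].

Definition good_rank3 (T : finType) (J : {set {set T}}) :=
  [/\ is_matroid J, forall X, X \in J -> #|X| <= 3, ~ restriction_iso J W3 & ~ restriction_iso J MK4].

Lemma code_inj (T : finType) (J J' : {set {set T}}) : good_rank3 J -> good_rank3 J' ->
  code J = code J' -> triples J = triples J'.
Proof.
move=> [mJ J3 noW noM] [mJ' J3' noW' noM'] E; apply/setP => X; rewrite !inE.
case: eqP => [/card3P[x [y [z [xy yz xz ->]]]]|]; last by rewrite !andbF.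
rewrite !andbT (triple_decode mJ J3 noW noM xy yz xz).
by rewrite (triple_decode mJ' J3' noW' noM' xy yz xz) E.
Qed.

Lemma code_sparse (d : nat) : exists n0, forall (T : finType) (J : {set {set T}}),
  good_rank3 J -> n0 <= #|T| -> d * #|(code J).2| <= #|T| ^ 2.
Proof.
have [n0 H] := sum_lines_small (2 * d); exists n0 => T J [mJ J3 noW noM] nT.
apply: leq_trans (H T (long_lines J) _ _ nT); last exact: long_lines_triangle_free.
  by rewrite [2 * d]mulnC -mulnA leq_mul2l card_line_code ?orbT.
by move=> L /(long_lineP mJ)[].
Qed.

(** * Counting sparse codes *)

(* Compare with the sum of s ^ #|~: A| over all sets A. *)
Lemma card_bounded_sets (S : finType) (s k : nat) : 0 < s ->
  #|[set A : {set S} | #|A| <= k]| * s ^ #|S| <= s ^ k * s.+1 ^ #|S|.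
Proof.
move=> s0; have -> : s.+1 ^ #|S| = \sum_(A : {set S}) s ^ #|~: A|.
  have := @bigA_distr _ 0 1 muln addn S (fun=> 1) (fun=> s).
  rewrite /= prod_nat_const add1n => ->; apply: eq_bigr => A _.
  rewrite (bigID (mem A)) /= big1 => [|i ->] //; rewrite mul1n.
  rewrite (eq_bigr (fun=> s)) => [|i /negbTE->] //.
  by rewrite -prod_nat_const; apply: eq_bigl => i; rewrite inE.
rewrite -sum_nat_const big_distrr /= [X in _ <= X](bigID (mem [set A : {set S} | #|A| <= k])) /=.
apply: leq_trans (leq_addr _ _); apply: leq_sum => A; rewrite inE => Ak.
by rewrite -expnD leq_pexp2l // -(cardsC A) leq_add2r.
Qed.

(** Bernoulli's inequality for [(1 - 1 / x) ^ j], with denominators cleared; truncated subtraction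
    makes it trivial for [x <= j]. *)
Lemma expn_bernoulli x j : x ^ j * (x - j) <= x * x.-1 ^ j.
Proof.
elim: j => [|j IH]; first by rewrite !expn0 subn0 mul1n muln1.
case: (leqP x j.+1) => [|lt]; first by rewrite -subn_eq0 => /eqP->; rewrite muln0.
apply: (@leq_trans (x ^ j * (x - j) * x.-1)); last by rewrite [_ ^ j.+1]expnSr mulnA leq_mul2r IH orbT.
by rewrite expnSr -!mulnA leq_mul2l; apply/orP; right; nia.
Qed.

Lemma expn_half j : 0 < j -> j.*2 ^ j <= 2 * j.*2.-1 ^ j.
Proof.
move=> j0; have := expn_bernoulli j.*2 j.
have -> : j.*2 - j = j by lia.
by move: (_ ^ j) (_ ^ j) => X Y; rewrite -muln2 -mulnA [j * _]mulnC leq_pmul2r.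
Qed.

Lemma card_sparse_sets (S : finType) (j k : nat) : 0 < j -> 2 * j * j * k <= #|S| ->
  #|[set A : {set S} | #|A| <= k]| ^ j <= 2 ^ (2 * #|S|).
Proof.
move=> j0 small; set N := #|[set A : {set S} | _]|.
(* With this weight [(1 + 1 / s) ^ j] is at most 2 by [expn_half], which costs [2 ^ #|S|]. The
   factor [s ^ (k * j)] costs another [2 ^ #|S|], because [s * k * j <= 2 * j * j * k]. *)
pose s := j.*2.-1; have s0 : 0 < s by rewrite /s; lia.
have sS : s.+1 = j.*2 by rewrite /s; lia.
have := card_bounded_sets S k s0; rewrite -/N => le1.
have : (N * s ^ #|S|) ^ j <= (s ^ k * s.+1 ^ #|S|) ^ j by rewrite leq_exp2r.
rewrite !expnMn -!expnM [#|S| * j]mulnC !(expnM _ j) sS => le2.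
have le3 : (j.*2 ^ j) ^ #|S| <= (2 * s ^ j) ^ #|S|.
  by case: #|S| => // m; rewrite leq_exp2r //; exact: expn_half.
have : N ^ j * (s ^ j) ^ #|S| <= s ^ (k * j) * (2 ^ #|S|) * (s ^ j) ^ #|S|.
  by apply: leq_trans le2 _; rewrite -mulnA -expnMn leq_mul.
rewrite leq_pmul2r ?expn_gt0 ?s0 // => /leq_trans; apply.
have s2 : s <= 2 ^ s by rewrite ltnW // ltn_expl.
apply: (@leq_trans (2 ^ (s * (k * j)) * 2 ^ #|S|)).
  rewrite leq_mul // [2 ^ _]expnM; case: (k * j) => // m.
  by rewrite leq_exp2r.
by rewrite -expnD leq_exp2l //; rewrite /s; nia.
Qed.

Lemma succ_sqr_le_expn u : 8 <= u -> u.+1 ^ 2 <= 2 ^ u.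
Proof.
elim: u => // u IH; rewrite leq_eqVlt => /orP[/eqP<- //|lt]; have le := IH lt.
rewrite [2 ^ _]expnS; apply: (@leq_trans (2 * u.+1 ^ 2)); last by rewrite leq_mul2l le.
by rewrite -!mulnn; move: lt {le IH}; rewrite ltnS => lt; nia.
Qed.

Lemma poly_le_expn j : exists n0, forall n, n0 <= n -> n.+1 ^ j <= 2 ^ n.
Proof.
case: j => [|j]; first by exists 0 => n _; rewrite expn0 expn_gt0.
exists (j.+1 * (j + 8)) => n le; pose u := n %/ j.+1.
have u_ge : j + 8 <= u by rewrite leq_divRL // mulnC.
have n_lt : n < u.+1 * j.+1 by rewrite ltn_ceil.
apply: (@leq_trans ((2 ^ u) ^ j.+1)).
  rewrite leq_exp2r //; apply: leq_trans (succ_sqr_le_expn _); last by lia.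
  by apply: leq_trans n_lt _; rewrite expnS expn1 leq_mul2l; apply/orP; right; lia.
by rewrite -expnM leq_exp2l // leq_divM.
Qed.

Lemma card_imset_factor (aT bT cT : finType) (f : aT -> bT) (g : aT -> cT) (A : {set aT}) :
  {in A &, forall x y, g x = g y -> f x = f y} -> #|f @: A| <= #|g @: A|.
Proof.
move=> H; have [-> | [a0 a0A]] := set_0Vmem A; first by rewrite !imset0 !cards0.
pose h c := f (odflt a0 [pick x in A | g x == c]).
apply: leq_trans (leq_imset_card h _); apply/subset_leq_card/subsetP => _ /imsetP[x xA ->].
apply/imsetP; exists (g x); first exact: imset_f.
rewrite /h; case: pickP => [y /andP[yA /eqP E]|/(_ x)] /=; last by rewrite xA eqxx.
exact/esym/H.
Qed.

Theorem count_rank3 (j : nat) : 0 < j -> exists n0, forall (T : finType) (F : {set {set {set T}}}),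
  n0 <= #|T| -> (forall J, J \in F -> good_rank3 J) ->
  #|[set triples J | J in F]| ^ j <= 2 ^ (3 * #|T| ^ 2).
Proof.
move=> j0; have [n1 H1] := code_sparse (2 * j * j); have [n2 H2] := poly_le_expn j.
exists (maxn n1 n2) => T F; rewrite geq_max => /andP[/H1 {}H1 /H2 {}H2] good.
set n := #|T| in H1 H2 *.
pose k := n ^ 2 %/ (2 * j * j).
pose D : {set {ffun T -> option T} * {set T * T}} := setX setT [set A : {set T * T} | #|A| <= k].
have le1 : #|[set triples J | J in F]| <= #|D|.
  apply: leq_trans (card_imset_factor (g := @code T) _) _.
    by move=> J J' JF J'F; apply: code_inj; apply: good.
  apply/subset_leq_card/subsetP => _ /imsetP[J JF ->].
  rewrite in_setX inE /= inE leq_divRL ?muln_gt0 ?j0 // mulnC.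
  exact/H1/good.
apply: (@leq_trans (#|D| ^ j)); first by rewrite leq_exp2r.
rewrite cardsX cardsT card_ffun card_option -/n expnMn.
(* One [n ^ 2] pays for the [n.+1 ^ n] maps to representatives, where [n.+1 ^ j <= 2 ^ n]; the other
   two pay for the sparse set of pairs. *)
have -> : 3 * n ^ 2 = n * n + 2 * #|{: T * T}| by rewrite card_prod -/n; lia.
rewrite expnD leq_mul //.
  by rewrite -expnM mulnC !expnM; case: (n) H2 => // m H2; rewrite leq_exp2r.
apply: card_sparse_sets => //.
by rewrite card_prod -/n mulnC leq_divM.
Qed.

(** * Shearer's inequality *)

Section Hoelder.
Local Open Scope ring_scope.

(** In [mahler_ineq], [P < S ^+ #|A|] is the negated goal, [x] is a summand of [S], and [t] lists
    the shares of the corresponding summand in the factors. Strictness needs [0 < x], since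
    otherwise the product may vanish. *)
Lemma agm_bound (I : finType) (A : {set I}) (t : I -> rat) (x S P : rat) :
  (0 < #|A|)%N -> (forall i, i \in A -> 0 <= t i) -> 0 <= x -> 0 < S -> P < S ^+ #|A| ->
  x ^+ #|A| <= P * \prod_(i in A) t i ->
  let mu := (\sum_(i in A) t i) / #|A|%:R in x <= S * mu /\ (0 < x -> x < S * mu).
Proof.
move=> A0 t0 x0 S0 PS le mu.
have mu0 : 0 <= mu by rewrite divr_ge0 // sumr_ge0.
have Smu0 : 0 <= S * mu by rewrite mulr_ge0 // ltW.
have agm : \prod_(i in A) t i <= mu ^+ #|A| by have [] := leif_AGM (A := mem A) t0.
have pt0 : 0 <= \prod_(i in A) t i by apply: prodr_ge0.
have S_agm : S ^+ #|A| * \prod_(i in A) t i <= (S * mu) ^+ #|A|.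
  by rewrite exprMn ler_pM2l // exprn_gt0.
split=> [|xpos].
  rewrite -(ler_pXn2r A0) ?nnegrE //; apply: le_trans le _; apply: le_trans _ S_agm.
  by rewrite ler_wpM2r // ltW.
have p_gt0 : 0 < \prod_(i in A) t i.
  rewrite lt0r pt0 andbT; apply/eqP => p0.
  by move: le; rewrite p0 mulr0 leNgt exprn_gt0.
rewrite -(ltr_pXn2r A0) ?nnegrE //; apply: le_lt_trans le _; apply: lt_le_trans _ S_agm.
by rewrite ltr_pM2r.
Qed.

(* Hoelder's inequality for sums of two geometric means, raised to the power #|A| to stay
   in nat; M collects the blocks that do not see the element being split in shearer. *)
Lemma mahler_ineq (I : finType) (A : {set I}) (a b : I -> nat) (M x y : nat) :
  (0 < #|A|)%N -> (x ^ #|A| <= M * \prod_(i in A) a i)%N ->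
  (y ^ #|A| <= M * \prod_(i in A) b i)%N ->
  ((x + y) ^ #|A| <= M * \prod_(i in A) (a i + b i))%N.
Proof.
move=> A0 lea leb; rewrite leqNgt; apply/negP => lt.
pose c i : rat := (a i + b i)%:R.
pose t i : rat := (a i)%:R / c i; pose s i : rat := (b i)%:R / c i.
pose P : rat := (M * \prod_(i in A) (a i + b i))%:R.
pose S : rat := (x + y)%:R.
have PS : P < S ^+ #|A| by rewrite /P /S -natrX ltr_nat.
have S0 : 0 < S.
  rewrite ltr0n lt0n; apply: contraTneq lt => ->.
  by rewrite exp0n // -leqNgt.
have ca i : t i * c i = (a i)%:R.
  rewrite /t /c; case: (posnP (a i + b i)%N) => [/eqP|ab].
    by rewrite addn_eq0 => /andP[/eqP-> _]; rewrite !mul0r.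
  by rewrite divfK // pnatr_eq0 -lt0n.
have cb i : s i * c i = (b i)%:R.
  rewrite /s /c; case: (posnP (a i + b i)%N) => [/eqP|ab].
    by rewrite addn_eq0 => /andP[_ /eqP->]; rewrite !mul0r.
  by rewrite divfK // pnatr_eq0 -lt0n.
have ts i : t i + s i <= 1.
  rewrite /t /s -mulrDl -natrD -/(c i).
  case: (eqVneq (c i) 0) => [->|c0]; first by rewrite mul0r.
  by rewrite divff.
have t0 i : i \in A -> 0 <= t i by rewrite /t divr_ge0.
have s0 i : i \in A -> 0 <= s i by rewrite /s divr_ge0.
have PE u v : (forall i, v i * c i = (u i)%:R) ->
    (M * \prod_(i in A) u i)%:R = P * \prod_(i in A) v i.
  move=> E; rewrite /P !natrM -mulrA; congr (_ * _); rewrite !natr_prod -big_split /=.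
  by apply: eq_bigr => i _; rewrite -E mulrC.
have [|x1 x2] := agm_bound A0 t0 (ler0n _ x) S0 PS.
  by rewrite -(PE _ _ ca) -natrX ler_nat.
have [|y1 y2] := agm_bound A0 s0 (ler0n _ y) S0 PS.
  by rewrite -(PE _ _ cb) -natrX ler_nat.
move: x1 x2 y1 y2; set mu := _ / _; set nu := _ / _ => x1 x2 y1 y2.
(* The two shares in a factor add up to at most 1, hence so do their means; one strict bound then
   contradicts [S = x + y]. *)
have munu : S * mu + S * nu <= S.
  rewrite -mulrDr -[leRHS]mulr1 ler_pM2l // /mu /nu -mulrDl ler_pdivrMr ?ltr0n // mul1r.
  by rewrite -big_split /= -sumr_const; apply: ler_sum => i _; exact: ts.
have SE : S = x%:R + y%:R by rewrite /S natrD.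
have [x0|xpos] := posnP x; last by have := x2; rewrite ltr0n => /(_ xpos); lra.
have [y0|ypos] := posnP y; last by have := y2; rewrite ltr0n => /(_ ypos); lra.
by move: S0; rewrite SE x0 y0; lra.
Qed.
End Hoelder.

Definition trace (X : finType) (F : {set {set X}}) (B : {set X}) := [set S :&: B | S in F].

(** Induction on [Y], splitting [F] by membership of [y]. In a block containing [y] the traces of
    the two halves stay distinct, so their numbers add; in the other blocks both are merely bounded
    by the full trace. Exactly [k] blocks contain [y], which is the exponent required by
    [mahler_ineq]. *)
Theorem shearer (X I : finType) (B : I -> {set X}) (A : {set I}) (k : nat)
    (Y : {set X}) (F : {set {set X}}) :
  0 < k -> (forall S, S \in F -> S \subset Y) ->
  (forall x, x \in Y -> #|[set i in A | x \in B i]| = k) ->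
  #|F| ^ k <= \prod_(i in A) #|trace F (B i)|.
Proof.
move=> k0; have [m le_m] := ubnP #|Y|; elim: m Y F le_m => // m IH Y F /ltnSE le_m FY cov.
have [F0|[S0 S0F]] := set_0Vmem F; first by rewrite F0 cards0 exp0n.
have [Y0|[y yY]] := set_0Vmem Y.
  have -> : F = [set set0].
    apply/setP => S; rewrite inE; apply/idP/eqP => [/FY|->]; first by rewrite Y0 subset0 => /eqP.
    by move: (FY _ S0F); rewrite Y0 subset0 => /eqP<-.
  rewrite cards1 exp1n prodn_gt0 // => i.
  by apply/card_gt0P; exists (set0 :&: B i); apply: imset_f; rewrite inE.
pose F0 := [set S in F | y \notin S].
pose F1' := [set S in F | y \in S].
pose F1 := [set S :\ y | S in F1'].
have cF : #|F| = #|F0| + #|F1|.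
  rewrite /F1 card_in_imset; last first.
    move=> S S'; rewrite !inE => /andP[_ yS] /andP[_ yS'] E.
    by rewrite -(setD1K yS) -(setD1K yS') E.
  rewrite -(cardsID F1' F) addnC; congr (_ + _); apply: eq_card => S; rewrite !inE;
    by case: (S \in F); case: (y \in S).
have sub0 S : S \in F0 -> S \subset Y :\ y.
  by rewrite inE subsetD1 => /andP[/FY-> ->].
have sub1 S : S \in F1 -> S \subset Y :\ y.
  by case/imsetP => S'; rewrite inE => /andP[/FY S'Y _] ->; exact: setSD.
have cY : #|Y :\ y| < m by move: le_m; rewrite (cardsD1 y) yY.
have cov' x : x \in Y :\ y -> #|[set i in A | x \in B i]| = k.
  by move=> /setD1P[_]; exact: cov.
have IH0 := IH _ F0 cY sub0 cov'; have IH1 := IH _ F1 cY sub1 cov'.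
pose Ay := [set i in A | y \in B i].
have Ak : #|Ay| = k by exact: cov.
pose M := \prod_(i in A :\: Ay) #|trace F (B i)|.
have split (g : I -> nat) : \prod_(i in A) g i = (\prod_(i in A :\: Ay) g i) * \prod_(i in Ay) g i.
  rewrite (bigID (mem Ay)) mulnC /=; congr (_ * _); apply: eq_bigl => i;
    by rewrite !inE; case: (i \in A); case: (y \in B i).
have tr0 i : trace F0 (B i) \subset trace F (B i).
  by apply: imsetS; apply/subsetP => S; rewrite inE => /andP[].
have tr1 i : y \notin B i -> trace F1 (B i) \subset trace F (B i).
  move=> yB; apply/subsetP => _ /imsetP[_ /imsetP[S + ->] ->]; rewrite inE => /andP[SF _].
  apply/imsetP; exists S => //; apply/setP => x; rewrite !inE.
  by case: eqVneq => //= ->; rewrite (negbTE yB) andbF.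
have tr2 i : y \in B i -> #|trace F0 (B i)| + #|trace F1 (B i)| <= #|trace F (B i)|.
  move=> yB; pose T1 := [set y |: S | S in trace F1 (B i)].
  have ny S : S \in trace F1 (B i) -> y \notin S.
    by case/imsetP => _ /imsetP[S' _ ->] ->; rewrite !inE eqxx.
  have -> : #|trace F1 (B i)| = #|T1|.
    rewrite [RHS]card_in_imset // => S S' /ny yS /ny yS' E.
    by rewrite -(setU1K yS) -(setU1K yS') E.
  have dis : [disjoint trace F0 (B i) & T1].
    apply/pred0P => S /=; apply/negP => /andP[/imsetP[S']]; rewrite inE => /andP[_ yS'] ->.
    case/imsetP => S'' _ /setP/(_ y); rewrite !inE eqxx /= (negbTE yS') //.
  have <- : #|trace F0 (B i) :|: T1| = #|trace F0 (B i)| + #|T1|.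
    by apply/eqP; rewrite (leq_card_setU _ _).
  apply/subset_leq_card; rewrite subUset tr0; apply/subsetP => _ /imsetP[_ /imsetP[_ /imsetP[S + ->] ->] ->].
  rewrite inE => /andP[SF yS]; apply/imsetP; exists S => //.
  by apply/setP => x; rewrite !inE; case: eqVneq => //= ->; rewrite yS yB.
rewrite cF -Ak split.
apply: leq_trans (_ : M * \prod_(i in Ay) (#|trace F0 (B i)| + #|trace F1 (B i)|) <= _); last first.
  rewrite leq_mul2l; apply/orP; right; apply: leq_prod => i; rewrite inE => /andP[_]; exact: tr2.
apply: mahler_ineq; rewrite ?Ak //.
  apply: leq_trans IH0 _; rewrite split leq_mul2r; apply/orP; right.
  by apply: leq_prod => i _; exact/subset_leq_card.
apply: leq_trans IH1 _; rewrite split leq_mul2r; apply/orP; right.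
apply: leq_prod => i; rewrite !inE => /andP[+ iA]; rewrite iA /= => yB.
exact/subset_leq_card/tr1.
Qed.

(** * Sparse paving matroids and binomial estimates *)

Definition sparse_paving (T : finType) (r : nat) (D : {set {set T}}) :=
  [set X : {set T} | (#|X| <= r) && (X \notin D)].

(** Augmentation by one candidate can fail only by landing in [D]. A second candidate then works, as
    two extensions of [Y] are never both in [D]; without one, [Z] would itself be the forbidden
    set. *)
Lemma sparse_paving_matroid (T : finType) (r : nat) (D : {set {set T}}) : 0 < r ->
  (forall X, X \in D -> #|X| = r) ->
  (forall (Y : {set T}) y z, y \notin Y -> z \notin Y -> y |: Y \in D -> z |: Y \in D -> y = z) ->
  is_matroid (sparse_paving r D).
Proof.
move=> r0 Dr dist; apply/and3P; split.
- rewrite inE cards0 /=; apply/negP => /Dr; rewrite cards0 => E.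
  by rewrite -E in r0.
- apply/forallP => Y; apply/forallP => X; apply/implyP; rewrite !inE => /andP[/andP[Yr YD] XY].
  have cXY := subset_leq_card XY; rewrite (leq_trans cXY) //=.
  apply: contra YD => XD; suff <- : X = Y by [].
  by apply/eqP; rewrite eqEcard XY (Dr _ XD) Yr.
apply/forallP => Y; apply/forallP => Z; apply/implyP; rewrite !inE => /and3P[/andP[_ YD] /andP[Zr ZD] lt].
have /card_gt0P[z zZY] : 0 < #|Z :\: Y|.
  by rewrite cardsD subn_gt0; apply: leq_ltn_trans (subset_leq_card (subsetIr _ _)) lt.
have [zY zZ] : z \notin Y /\ z \in Z by move: zZY; rewrite inE => /andP[].
have cz t : t \notin Y -> #|t |: Y| <= r.
  by move=> tY; rewrite cardsU1 tY add1n (leq_trans lt).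
case: (boolP (z |: Y \in D)) => zD; last first.
  by apply/existsP; exists z; rewrite zZY inE cz // zD.
case: (boolP (Z :\: Y \subset [set z])) => [sub|/subsetPn[t tZY]]; last first.
  have tY : t \notin Y by move: tZY; rewrite inE => /andP[].
  rewrite inE => tz; apply/existsP; exists t; rewrite tZY inE cz //=.
  by apply: contra tz => tD; apply/eqP; exact: (dist Y).
case/negP: ZD; suff -> : Z = z |: Y by [].
apply/eqP; rewrite eqEcard setUC -subDset sub /=.
by rewrite setUC cardsU1 zY add1n.
Qed.

Definition sum_class (n r : nat) (s : 'I_n.+1) :=
  [set X : {set 'I_n.+1} | (#|X| == r) && (\sum_(i in X) i == s %[mod n.+1])].

Lemma sum_class_dist n r (s : 'I_n.+1) (Y : {set 'I_n.+1}) y z : y \notin Y -> z \notin Y ->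
  y |: Y \in sum_class r s -> z |: Y \in sum_class r s -> y = z.
Proof.
move=> yY zY; rewrite !inE !big_setU1 //= => /andP[_ /eqP E1] /andP[_ /eqP E2].
apply/val_inj/eqP; have := E1; rewrite -E2 => /eqP; rewrite eqn_modDr.
by rewrite !modn_small.
Qed.

Lemma num_matroids_ge_class n r (s : 'I_n.+1) : 0 < r ->
  2 ^ #|sum_class r s| <= num_matroids n.+1.
Proof.
move=> r0; rewrite -card_powerset /num_matroids.
rewrite -(card_in_imset (f := @sparse_paving _ r) (D := powerset (sum_class r s))); last first.
  move=> D D'; rewrite !inE => sD sD' /setP E; apply/setP => X.
  have [rX|rX] := eqVneq #|X| r.
    by move: (E X); rewrite !inE rX leqnn /= => /negb_inj.
  have H (D0 : {set {set 'I_n.+1}}) : D0 \subset sum_class r s -> (X \in D0) = false.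
    move=> sub; apply/negbTE; apply: contra rX => /(subsetP sub).
    by rewrite inE => /andP[].
  by rewrite (H _ sD) (H _ sD').
apply/subset_leq_card/subsetP => I0 /imsetP[D]; rewrite inE => sD ->.
rewrite inE; apply: sparse_paving_matroid => //.
  by move=> X /(subsetP sD); rewrite inE => /andP[/eqP].
move=> Y y z yY zY /(subsetP sD) H1 /(subsetP sD) H2.
exact: sum_class_dist H1 H2.
Qed.

(** The [n] residue classes partition the [r]-sets. Multiplying their [n] bounds replaces choosing a
    largest class and keeps the statement free of division. *)
Theorem num_matroids_lower n r : 0 < n -> 0 < r -> 2 ^ 'C(n, r) <= num_matroids n ^ n.
Proof.
case: n => // n _ r0.
have -> : 'C(n.+1, r) = \sum_(s < n.+1) #|sum_class r s|.
  rewrite -[n.+1 in LHS]card_ord -card_draws -sum1_card.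
  pose f (X : {set 'I_n.+1}) : 'I_n.+1 := inord ((\sum_(i in X) i) %% n.+1).
  rewrite (partition_big f predT) //=; apply: eq_bigr => s _.
  rewrite -sum1_card; apply: eq_bigl => X; rewrite !inE; congr (_ && _).
  by rewrite -val_eqE /= inordK ?ltn_mod // [s %% _]modn_small.
rewrite expn_sum -[X in _ <= _ ^ X]card_ord -prod_nat_const.
by apply: leq_prod => s _; exact: num_matroids_ge_class.
Qed.

Lemma leq_bin_succ n r : r.*2 < n -> 'C(n, r) <= 'C(n, r.+1).
Proof.
move=> lt; rewrite -(@leq_pmul2l r.+1) // mul_bin_left leq_mul2r.
by apply/orP; right; lia.
Qed.

Lemma leq_bin_half n r : 'C(n, r) <= 'C(n, n./2).
Proof.
have low m d : m + d <= n./2 -> 'C(n, m) <= 'C(n, m + d).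
  elim: d => [|d IH] le; first by rewrite addn0.
  by rewrite addnS; apply: leq_trans (leq_bin_succ _); [apply: IH|]; lia.
have low' m : m <= n./2 -> 'C(n, m) <= 'C(n, n./2).
  by move=> le; have := @low m (n./2 - m); rewrite subnKC //; apply.
have [le|gt] := leqP r n./2; first exact: low'.
have [rn|nr] := leqP r n; last by rewrite bin_small.
by rewrite -bin_sub //; apply: low'; lia.
Qed.

(** Up to a third of [n], consecutive binomials have ratio at least 2. *)
Lemma bin_doubling n s j : 3 * (s + j) <= n -> 2 ^ j * 'C(n, s) <= 'C(n, s + j).
Proof.
elim: j => [|j IH] le; first by rewrite mul1n addn0.
rewrite addnS; apply: (@leq_trans (2 * 'C(n, s + j))).
  by rewrite expnS -mulnA leq_mul2l /= IH //; lia.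
rewrite -(@leq_pmul2l (s + j).+1) // mul_bin_left mulnA leq_mul2r.
by apply/orP; right; lia.
Qed.

Lemma linear_le_expn j : 8 <= j -> 24 * (j + 2) <= 2 ^ j.
Proof.
elim: j => // j IH; rewrite leq_eqVlt => /orP[/eqP<- //|/IH le].
by rewrite expnS; lia.
Qed.

(** From [s < n / 4] there are [j > n / 12 - 1] doublings up to [n / 3], and
    [2 ^ j >= 24 * (j + 2) >= 2 * n]. *)
Lemma bin_extreme n s : 120 <= n -> 4 * s < n -> 2 * n * 'C(n, s) <= 'C(n, n./2).
Proof.
move=> n_large lt; pose j := n %/ 3 - s.
have n3 : n < 3 * (n %/ 3) + 3 by rewrite {1}(divn_eq n 3) mulnC ltn_add2l ltn_mod.
have j8 : 8 <= j by rewrite /j; lia.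
have le : 3 * (s + j) <= n.
  by rewrite /j subnKC ?[3 * _]mulnC ?leq_divM //; lia.
apply: leq_trans (leq_bin_half _ (s + j)); apply: leq_trans (bin_doubling le).
rewrite leq_mul2r; apply/orP; right; apply: leq_trans (linear_le_expn j8).
by rewrite /j; lia.
Qed.

(** Both sides count the pairs of a [q]-set inside a [(q + 3)]-set. It converts the exponents coming
    from Shearer's inequality. *)
Lemma bin_contract n q : q + 3 <= n -> 'C(n, q) * 'C(n - q, 3) = 'C(n, q + 3) * 'C(q + 3, 3).
Proof.
move=> le.
have q_gt : 0 < q`! * 3`! * (n - q - 3)`! by rewrite !muln_gt0 !fact_gt0.
apply/eqP; rewrite -(eqn_pmul2r q_gt); apply/eqP.
have E1 := @bin_fact n q (ltac:(lia)); have E2 := @bin_fact (n - q) 3 (ltac:(lia)).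
have E3 := @bin_fact n (q + 3) le; have E4 := @bin_fact (q + 3) 3 (ltac:(lia)).
rewrite addnK in E4; rewrite subnDA in E3.
transitivity n`!.
  by rewrite -E1 -E2; ring.
by rewrite -E3 -E4; ring.
Qed.

(** Here 384 is [4 ^ 3 * 3!], since [m * (m - 1) * (m - 2)] is at least [(m - 3) ^ 3]. *)
Lemma bin3_ge n m : 3 <= m -> n <= 4 * (m - 3) -> n ^ 3 <= 384 * 'C(m, 3).
Proof.
move=> m3 le; have := bin_ffact m 3.
rewrite !ffactnS ffactn0 muln1 (_ : 3`! = 6) // => E.
have -> : 384 * 'C(m, 3) = 64 * (m * (m.-1 * m.-2)) by rewrite -E; ring.
apply: (@leq_trans ((4 * (m - 3)) ^ 3)); first by rewrite leq_exp2r.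
rewrite expnMn (_ : 4 ^ 3 = 64) // leq_mul2l /= !expnS expn0 muln1.
by rewrite !leq_mul //; lia.
Qed.

(** * Contractions and the final count *)

Lemma card_disjointU (T : finType) (A B : {set T}) :
  [disjoint A & B] -> #|A :|: B| = #|A| + #|B|.
Proof. by move=> dis; apply/eqP; rewrite (leq_card_setU _ _). Qed.

Section Rank.
Variables (T : finType) (I : {set {set T}}).
Hypothesis mI : is_matroid I.

Lemma mrank_ge (X Y : {set T}) : Y \in I -> Y \subset X -> #|Y| <= mrank I X.
Proof.
by move=> YI YX; apply: (leq_bigmax_cond (F := fun Y : {set T} => #|Y|)); rewrite YI.
Qed.

Lemma mrank_attained (X : {set T}) : exists Y, [/\ Y \in I, Y \subset X & #|Y| = mrank I X].
Proof.
rewrite /mrank (bigop.bigmax_eq_arg set0) ?(indep0 mI) ?sub0set //.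
case: arg_maxnP => [|Y /andP[YI YX] _]; first by rewrite (indep0 mI) sub0set.
by exists Y.
Qed.

Lemma mrank_indep X : X \in I -> mrank I X = #|X|.
Proof.
move=> XI; apply/eqP; rewrite eqn_leq mrank_ge // andbT.
by have [Y [_ YX <-]] := mrank_attained X; apply: subset_leq_card.
Qed.

Lemma mrank_eq_card X : (mrank I X == #|X|) = (X \in I).
Proof.
apply/eqP/idP => [E|]; last exact: mrank_indep.
have [Y [YI YX cY]] := mrank_attained X.
by suff <- : Y = X by []; apply/eqP; rewrite eqEcard YX cY E /=.
Qed.

Lemma indep_contractE C X : C \in I ->
  indep_contract I C X = [disjoint X & C] && (X :|: C \in I).
Proof.
move=> CI; rewrite /indep_contract (mrank_indep CI); case: (boolP [disjoint X & C]) => //= dis.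
by rewrite -mrank_eq_card card_disjointU.
Qed.

Lemma extend_to_basis Y : Y \in I ->
  exists Z, [/\ Z \in I, Y \subset Z & #|Z| = mrank I setT].
Proof.
move=> YI; have [m] := ubnP (mrank I setT - #|Y|); elim: m Y YI => // m IH Y YI /ltnSE le_m.
have := mrank_ge YI (subsetT _); rewrite leq_eqVlt => /orP[/eqP E|lt].
  by exists Y.
have [B [BI _ cB]] := mrank_attained setT.
have [|z [_ zY zYI]] := indep_augment mI YI BI; first by rewrite cB.
have [|Z [ZI sub cZ]] := IH _ zYI; first by rewrite cardsU1 zY; lia.
by exists Z; split=> //; apply: subset_trans sub; exact: subsetU1.
Qed.

Definition contraction (C : {set T}) := [set X : {set T} | [disjoint X & C] && (X :|: C \in I)].

Lemma contraction_matroid C : C \in I -> is_matroid (contraction C).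
Proof.
move=> CI; apply/and3P; split.
- by rewrite inE disjoints_subset sub0set set0U.
- apply/forallP => Y; apply/forallP => X; apply/implyP; rewrite !inE => /andP[/andP[dY YI] XY].
  by rewrite (disjointWl XY dY) (indepS mI _ YI) // setSU.
apply/forallP => Y; apply/forallP => Z; apply/implyP; rewrite !inE.
case/and3P => /andP[dY YI] /andP[dZ ZI] lt.
have [|z [zZC zYC zI]] := indep_augment mI YI ZI; first by rewrite !card_disjointU // ltn_add2r.
move: zZC zYC; rewrite !inE negb_or => /orP[zZ|zC] /andP[zY zC']; last by rewrite zC in zC'.
apply/existsP; exists z; rewrite !inE zY zZ -setUA zI andbT.
by rewrite /= andbT disjoints_subset subUset sub1set inE zC' -disjoints_subset.
Qed.

(** Elements of [C] are loops of the contraction, so independence of the singletons of [N] keeps the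
    image of [f] away from [C]. *)
Lemma contraction_restriction C k (N : {set {set 'I_k}}) : C \in I ->
  (forall i, [set i] \in N) -> restriction_iso (contraction C) N -> has_minor_iso I N.
Proof.
move=> CI N1 [f f_inj fN]; apply/existsP; exists C; apply/existsP; exists [ffun i => f i].
have E (S : {set 'I_k}) : [ffun i => f i] @: S = f @: S by apply: eq_imset => i; rewrite ffunE.
apply/and3P; split.
- by apply/injectiveP => i j; rewrite !ffunE; exact: f_inj.
- rewrite E disjoint_sym disjoints_subset; apply/subsetP => _ /imsetP[i _ ->].
  have := fN [set i]; rewrite N1 imset_set1 inE => /esym/andP[+ _].
  by rewrite disjoints_subset sub1set.
by apply/forallP => S; rewrite fN E indep_contractE // inE.
Qed.
End Rank.

Lemma singleton_W3 i : [set i] \in W3.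
Proof.
rewrite inE cards1 /=.
have ne (A : {set 'I_6}) : #|A| = 3 -> [set i] != A.
  by move=> A3; apply/eqP => E; move: A3; rewrite -E cards1.
by rewrite !ne ?cards3.
Qed.

Lemma singleton_MK4 i : [set i] \in MK4.
Proof.
rewrite inE cards1 /=.
have ne (A : {set 'I_6}) : #|A| = 3 -> [set i] != A.
  by move=> A3; apply/eqP => E; move: A3; rewrite -E cards1.
by rewrite !ne ?cards3.
Qed.

Definition excluding n (r : nat) := [set I : {set {set 'I_n}} |
  [&& is_matroid I, ~~ has_minor_iso I W3, ~~ has_minor_iso I MK4 & mrank I setT == r]].

Definition bases (T : finType) (r : nat) (I : {set {set T}}) := [set X in I | #|X| == r].

Lemma bases_inj n r : {in excluding n r &, injective (@bases _ r)}.
Proof.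
move=> I I'; rewrite !inE => /and4P[mI _ _ /eqP rI] /and4P[mI' _ _ /eqP rI'] /setP E.
have half (J J' : {set {set 'I_n}}) X : is_matroid J -> is_matroid J' -> mrank J setT = r ->
    bases r J =i bases r J' -> X \in J -> X \in J'.
  move=> mJ mJ' rJ E' /(extend_to_basis mJ)[Z [ZJ XZ cZ]].
  have : Z \in bases r J' by rewrite -E' inE ZJ cZ rJ eqxx.
  by rewrite inE => /andP[ZJ' _]; exact (indepS mJ' XZ ZJ').
apply/setP => X; apply/idP/idP; apply: half => // Y; by rewrite E.
Qed.

Lemma contraction_good n r (I : {set {set 'I_n}}) C : I \in excluding n (r + 3) -> C \in I ->
  #|C| = r -> good_rank3 (contraction I C).
Proof.
rewrite inE => /and4P[mI noW noM /eqP rI] CI cC; split.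
- exact: contraction_matroid.
- move=> X; rewrite inE => /andP[dX XI].
  have := mrank_ge XI (subsetT _); rewrite rI card_disjointU //.
  by rewrite cC addnC leq_add2l.
- by move/(contraction_restriction mI CI singleton_W3); apply/negP.
- by move/(contraction_restriction mI CI singleton_MK4); apply/negP.
Qed.

Definition above (T : finType) (C : {set T}) := [set X : {set T} | C \subset X].

(** The bases above an independent [C] are the triples of the contraction joined with [C]; a
    dependent [C] gives the empty trace, the extra 1. Its cost [2 ^ j] is absorbed because
    [j <= n]. *)
Lemma card_trace_above j : 0 < j -> exists n0, forall n r (C : {set 'I_n}), n0 <= n -> #|C| = r ->
  #|trace [set bases (r + 3) I | I in excluding n (r + 3)] (above C)| ^ j <= 2 ^ (4 * n ^ 2).
Proof.
move=> j0; have [n1 H1] := count_rank3 j0.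
exists (maxn n1 j) => n r C; rewrite geq_max => /andP[n1n jn] cC.
pose JJ := [set contraction I C | I in [set I in excluding n (r + 3) | C \in I]].
set t := #|trace _ _|.
have le1 : t <= 1 + #|[set triples J | J in JJ]|.
  pose g (X : {set {set 'I_n}}) := [set Y :|: C | Y in X].
  apply: (@leq_trans #|set0 |: g @: [set triples J | J in JJ]|); last first.
    by apply: leq_trans (leq_card_setU _ _) _; rewrite cards1 leq_add2l leq_imset_card.
  apply/subset_leq_card/subsetP => _ /imsetP[_ /imsetP[I IE ->] ->].
  have mI : is_matroid I by move: IE; rewrite inE => /and4P[].
  rewrite in_setU1; case: (boolP (C \in I)) => CI; last first.
    apply/orP; left; apply/eqP/setP => X; rewrite !inE; apply/negbTE.
    by apply: contra CI => /andP[/andP[XI _] CX]; exact (indepS mI CX XI).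
  apply/orP; right; apply/imsetP; exists (triples (contraction I C)).
    by apply: imset_f; apply: imset_f; rewrite inE IE.
  apply/setP => X; apply/idP/imsetP => [|[Y + ->]].
    rewrite !inE => /andP[/andP[XI /eqP cX] CX].
    have XE : (X :\: C) :|: C = X by rewrite setUC -[RHS](setID X C) (setIidPr CX).
    exists (X :\: C); last by rewrite XE.
    rewrite inE [_ \in contraction _ _]inE XE XI disjoints_subset subsetDr /=.
    by rewrite cardsD (setIidPr CX) cX cC addKn.
  rewrite inE [_ \in contraction _ _]inE => /andP[/andP[dY YI] /eqP cY].
  rewrite inE [_ \in bases _ _]inE YI [_ \in above _]inE subsetUr andbT /=.
  by rewrite card_disjointU // cY cC addnC.
have le2 : #|[set triples J | J in JJ]| ^ j <= 2 ^ (3 * n ^ 2).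
  rewrite -[n in 2 ^ (3 * n ^ 2)]card_ord; apply: H1; first by rewrite card_ord.
  move=> _ /imsetP[I + ->]; rewrite inE => /andP[IE CI].
  exact: contraction_good IE CI cC.
apply: (@leq_trans ((1 + #|[set triples J | J in JJ]|) ^ j)); first by rewrite leq_exp2r.
move: #|_| le2 => R le2.
have le3 : (1 + R) ^ j <= 2 ^ j * 2 ^ (3 * n ^ 2).
  case: R le2 => [|R] le2; first by rewrite exp1n muln_gt0 !expn_gt0.
  apply: leq_trans (leq_mul (leqnn _) le2).
  by rewrite -expnMn leq_exp2r //; lia.
apply: leq_trans le3 _; rewrite -expnD leq_exp2l //.
by rewrite -mulnn; nia.
Qed.

(** Shearer's inequality on the ground set of [(r + 3)]-sets, one block for each [r]-set [C]: an
    [(r + 3)]-set lies in ['C(r + 3, 3)] blocks. *)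
Lemma card_excluding j : 0 < j -> exists n0, forall n r, n0 <= n -> r + 3 <= n ->
  #|excluding n (r + 3)| ^ (j * 'C(n - r, 3)) <= 2 ^ (4 * n ^ 2 * 'C(n, r + 3)).
Proof.
move=> j0; have [n0 H] := card_trace_above j0; exists n0 => n r n0n rn.
set m := #|excluding _ _|.
pose A := [set C : {set 'I_n} | #|C| == r].
have cA : #|A| = 'C(n, r) by rewrite card_draws card_ord.
pose b := 'C(r + 3, 3); have b0 : 0 < b by rewrite bin_gt0 leq_addl.
have sh : m ^ b <= \prod_(C in A) #|trace [set bases (r + 3) I | I in excluding n (r + 3)] (above C)|.
  rewrite /m -(card_in_imset (@bases_inj n (r + 3))).
  apply: (@shearer _ _ _ _ _ [set X : {set 'I_n} | #|X| == r + 3]) => //.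
    by move=> _ /imsetP[I _ ->]; apply/subsetP => X; rewrite !inE => /andP[].
  move=> X; rewrite inE => /eqP cX; rewrite /b -(@bin_sub (r + 3)) ?leq_addl // addnK -cX -cards_draws.
  by apply: eq_card => C; rewrite !inE andbC.
have le : m ^ (b * j) <= 2 ^ (4 * n ^ 2 * 'C(n, r)).
  rewrite expnM; apply: (@leq_trans ((\prod_(C in A) 
    #|trace [set bases (r + 3) I | I in excluding n (r + 3)] (above C)|) ^ j)).
    by rewrite leq_exp2r.
  rewrite (big_morph (fun x => x ^ j) (fun x y => expnMn x y j) (exp1n j)).
  rewrite expnM -cA -prod_nat_const; apply: leq_prod => C; rewrite inE => /eqP cC.
  exact: H.
have bE := bin_contract rn.
rewrite -(@leq_exp2r _ _ b) // -!expnM.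
have -> : 4 * n ^ 2 * 'C(n, r + 3) * b = 4 * n ^ 2 * 'C(n, r) * 'C(n - r, 3) by rewrite -!mulnA bE.
have -> : j * 'C(n - r, 3) * b = b * j * 'C(n - r, 3) by ring.
rewrite expnM [2 ^ _]expnM; case: 'C(n - r, 3) => // c.
by rewrite leq_exp2r.
Qed.

Lemma card_excluding_trivial n r : #|excluding n r| <= 2 ^ 'C(n, r).
Proof.
rewrite -(card_in_imset (@bases_inj n r)) -[n in 'C(n, _)]card_ord -card_draws -card_powerset.
apply/subset_leq_card/subsetP => _ /imsetP[I _ ->]; rewrite inE.
by apply/subsetP => X; rewrite !inE => /andP[].
Qed.

Lemma card_excluding_rank : exists n0, forall n r, n0 <= n -> r <= n ->
  #|excluding n r| ^ (2 * n) <= 2 ^ 'C(n, n./2).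
Proof.
(* The comparison needs [2 * n * (4 * n ^ 2) = 8 * n ^ 3 <= j * 'C(n - r + 3, 3)], and [bin3_ge]
   supplies 384. The existential keeps the numeral from being unfolded. *)
have [j jE] : exists j, j = 8 * 384 by eexists.
have j0 : 0 < j by rewrite jE.
have [n1 H] := card_excluding j0.
exists (maxn 120 n1) => n r; rewrite geq_max => /andP[n120 n1n] rn.
have n0 : 0 < n by exact: leq_trans n120.
set m := #|_|.
have extreme : 2 * n * 'C(n, r) <= 'C(n, n./2) -> m ^ (2 * n) <= 2 ^ 'C(n, n./2).
  move=> le; apply: (@leq_trans ((2 ^ 'C(n, r)) ^ (2 * n))).
    by rewrite leq_exp2r ?card_excluding_trivial // muln_gt0.
  by rewrite -expnM leq_exp2l // mulnC.
case: (leqP 3 r) => [r3|r3]; last by apply/extreme/bin_extreme => //; lia.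
case: (leqP n (4 * (n - r))) => [nr|nr]; last first.
  by apply: extreme; rewrite -bin_sub //; apply: bin_extreme.
apply: (@leq_trans (2 ^ 'C(n, r))); last by rewrite leq_exp2l // leq_bin_half.
have rE : r = r - 3 + 3 by lia.
have := H n (r - 3) n1n; rewrite -rE -/m => /(_ rn).
have := @bin3_ge n (n - (r - 3)).
move: ('C(_ - _, 3)) => c /(_ (ltac:(lia)) (ltac:(lia))) c_ge le.
have sq : 0 < 4 * n ^ 2 by rewrite muln_gt0 expn_gt0 n0.
rewrite -(@leq_exp2r _ _ (4 * n ^ 2)) // -!expnM ['C(n, r) * _]mulnC.
apply: leq_trans le; case: (posnP m) => [->|m0].
  by rewrite exp0n // !muln_gt0 n0.
rewrite leq_pexp2l // jE -mulnA.
have -> : 2 * (n * (4 * n ^ 2)) = 8 * n ^ 3 by ring.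
by rewrite -mulnA leq_mul2l.
Qed.

Lemma num_matroids_gt0 n : 0 < num_matroids n.
Proof.
have [->|n0] := posnP n; last first.
  have := num_matroids_lower n0 n0; rewrite binn; case: (num_matroids n) => //.
  by rewrite exp0n.
apply/card_gt0P; exists [set set0]; rewrite inE; apply/and3P; split.
- by rewrite inE.
- apply/forallP => Y; apply/forallP => X; apply/implyP; rewrite !inE => /andP[/eqP->].
  by rewrite subset0.
- apply/forallP => Y; apply/forallP => Z; apply/implyP; rewrite !inE.
  by case/and3P => /eqP-> /eqP->; rewrite cards0.
Qed.

(** Comparing squares avoids roots: every rank contributes at most the square root of [N], so
    [K ^ 2 * n.+1 ^ 2 < N] suffices, which follows from [K ^ 2 <= n] and
    [n.+1 ^ 3 <= 2 ^ n <= N]. *)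
Theorem num_excl_negligible (K : nat) : exists n0, forall n, n0 <= n ->
  K * num_excl n < num_matroids n.
Proof.
have [n1 H1] := card_excluding_rank; have [n2 H2] := poly_le_expn 3.
exists (maxn (maxn n1 n2) (maxn 120 (K ^ 2))) => n.
rewrite !geq_max => /andP[/andP[/H1 {}H1 /H2 {}H2] /andP[n_large nK]].
have n0 : 0 < n by exact: leq_trans n_large.
have h0 : 0 < n./2 by lia.
have low := num_matroids_lower n0 h0.
set N := num_matroids n in low *.
have sq r : r <= n -> #|excluding n r| ^ 2 <= N.
  move=> rn; rewrite -(@leq_exp2r _ _ n) // -expnM.
  exact: leq_trans (H1 r rn) low.
have [r [rn le]] : exists r, r <= n /\ num_excl n <= n.+1 * #|excluding n r|.
  have [r0 Er0] := @bigop.eq_bigmax 'I_n.+1 (fun r => #|excluding n r|) (ltac:(by rewrite card_ord)).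
  exists r0; split; first by rewrite -ltnS.
  rewrite -Er0 /num_excl -sum1_card.
  have rk (I : {set {set 'I_n}}) : mrank I setT < n.+1.
    by rewrite ltnS; apply/bigmax_leqP => Y _; rewrite -[leqRHS]card_ord max_card.
  rewrite (partition_big (fun I => Ordinal (rk I)) predT) //=.
  rewrite -[X in _ <= X * _]card_ord -sum_nat_const; apply: leq_sum => r _.
  apply: leq_trans (bigop.leq_bigmax (F := fun r : 'I_n.+1 => #|excluding n r|) r); rewrite sum1_card; apply: eq_leq; apply: eq_card => I.
  by rewrite [LHS]unfold_in /= [X in X && _]inE [RHS]inE -val_eqE /= -!andbA.
(* After taking [n]-th powers this asks for [n ^ 2 <= 'C(n, n./2)]. The central binomial is at least
   [2 ^ (n %/ 3)], hence at least the square of [2 ^ i] with [i] about [n / 6], and [2 ^ i] exceeds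
   [n]. *)
have N_large : 2 ^ n <= N.
  rewrite -(@leq_exp2r _ _ n) // -expnM; apply: leq_trans low; rewrite leq_exp2l //.
  have := @bin_doubling n 0 (n %/ 3); rewrite bin0 muln1 mulnC add0n leq_divM => /(_ isT) le1.
  apply: leq_trans (leq_bin_half n (n %/ 3)); apply: leq_trans le1.
  pose i := n %/ 3 %/ 2.
  have n3 : n < 3 * (n %/ 3) + 3 by rewrite {1}(divn_eq n 3) mulnC ltn_add2l ltn_mod.
  have i2 : n %/ 3 < 2 * i + 2 by rewrite {1}(divn_eq (n %/ 3) 2) mulnC ltn_add2l ltn_mod.
  apply: (@leq_trans (2 ^ (i * 2))); last by rewrite leq_exp2l // leq_divM.
  rewrite expnM; apply: (@leq_trans ((24 * (i + 2)) ^ 2)).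
    by rewrite mulnn leq_exp2r //; lia.
  by rewrite leq_exp2r // linear_le_expn //; lia.
rewrite -(@ltn_exp2r _ _ 2) // expnMn.
apply: (@leq_ltn_trans (K ^ 2 * (n.+1 ^ 2 * N))).
  rewrite leq_mul2l; apply/orP; right.
  apply: (@leq_trans ((n.+1 * #|excluding n r|) ^ 2)); first by rewrite leq_exp2r.
  by rewrite expnMn leq_mul // sq.
rewrite mulnA -mulnn ltn_pmul2r ?num_matroids_gt0 //.
apply: (@leq_trans (n.+1 ^ 3)); last exact: leq_trans N_large.
by rewrite [n.+1 ^ 3]expnS ltn_pmul2r ?expn_gt0 // ltnS.
Qed.

Local Open Scope ring_scope.

Theorem theorem2 :
  forall eps : rat, 0 < eps ->
  exists N : nat, forall n : nat, (N <= n)%N ->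
    (num_excl n)%:R / (num_matroids n)%:R < eps.
Proof.
move=> eps eps0; have ei0 : 0 <= eps^-1 by rewrite invr_ge0 ltW.
have [N H] := num_excl_negligible (Num.bound eps^-1).
exists N => n /H lt; have M0 : 0 < (num_matroids n)%:R :> rat by rewrite ltr0n num_matroids_gt0.
rewrite ltr_pdivrMr // -ltr_pdivrMl //.
apply: le_lt_trans (_ : (Num.bound eps^-1 * num_excl n)%:R < _); last by rewrite ltr_nat.
by rewrite natrM ler_wpM2r // ltW // archi_boundP.
Qed.
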